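(* Given a graph $G$ with $n$ vertices and $m$ edges, a weight function $w\colon V(G)\to\mathbb{R}^+$, and an MT-partition $(K,\overline{M},S,M)$ of $G$, a maximum weighted independent set and a maximum weighted clique of $G$ can be computed in $\mathcal{O}(n+m)$-time.
   Context: All graphs are finite and simple. An MT-partition $(K,\overline{M},S,M)$ of a graph $G$ is a partition of $V(G)$ into four (possibly empty) sets such that: $S$ is independent; $M$ induces a matching (a 1-regular graph); $\overline{M}$ induces a complete graph minus a perfect matching; $K$ is a clique; $S$ is anticomplete to $M$ (no edges between them); and $K$ is complete to $\overline{M}$ (all edges between them). The weight of a vertex set is the sum of the weights of its vertices. *)

(* Defs.v *)
From HB Require Import structures.
From mathcomp Require Import all_boot all_order all_algebra.
From mathcomp Require Import reals.

Set Implicit Arguments.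
Unset Strict Implicit.
Unset Printing Implicit Defensive.

Import Order.TTheory GRing.Theory Num.Theory.
Local Open Scope ring_scope.

(* A finite simple graph on T is a symmetric irreflexive relation e : rel T. *)
Section Graphs.
Variable T : finType.
Implicit Types (e r : rel T) (A B : {set T}).

Definition edges e : {set {set T}} :=
  [set [set p.1; p.2] | p : T * T & e p.1 p.2].

Definition independent e A : Prop := {in A &, forall x y, ~~ e x y}.

Definition clique e A : Prop := {in A &, forall x y, x != y -> e x y}.

Definition anticomplete e A B : Prop :=
  {in A & B, forall x y, ~~ e x y}.

Definition complete_to e A B : Prop := {in A & B, forall x y, e x y}.

Definition induces_matching e A : Prop :=
  {in A, forall x, #|[set y in A | e x y]| = 1%N}.

Definition induces_complete_minus_perfect_matching e A : Prop :=
  exists r : rel T,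
    [/\ symmetric r, irreflexive r, induces_matching r A
      & {in A &, forall x y, e x y = (x != y) && ~~ r x y}].

(* The blocks may be empty, which rules out finset's [partition]. *)
Definition four_partition (K Mb S M : {set T}) : Prop :=
  [/\ K :|: Mb :|: S :|: M = [set: T], [disjoint K & Mb],
      [disjoint K :|: Mb & S] & [disjoint K :|: Mb :|: S & M]].

Definition MT_partition e (K Mb S M : {set T}) : Prop :=
  four_partition K Mb S M /\
  [/\ independent e S, induces_matching e M,
      induces_complete_minus_perfect_matching e Mb & clique e K] /\
  anticomplete e S M /\ complete_to e K Mb.

Section Weights.
Variables (R : numDomainType) (e : rel T) (w : T -> R).

Definition weight A : R := \sum_(x in A) w x.

Definition max_weight_independent A : Prop :=
  independent e A /\ forall B, independent e B -> weight B <= weight A.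

Definition max_weight_clique A : Prop :=
  clique e A /\ forall B, clique e B -> weight B <= weight A.

End Weights.
End Graphs.

(* Unit-cost RAM with indirect addressing. Memory consists of arrays of       *)
(* naturals and arrays of reals, both named by naturals (a scalar variable is *)
(* cell 0 of an array). Integer arithmetic is limited to addition and         *)
(* truncated subtraction; reals can only be copied, added, subtracted and     *)
(* compared, and are never converted to integers. The syntax does not mention *)
(* the field, so a program contains no real constant other than 0.            *)

Inductive nexp : Type :=
| NConst of nat
| NGet of nat & nexp
| NAdd of nexp & nexp
| NSub of nexp & nexp.

Inductive rexp : Type :=
| RZero
| RGet of nat & nexp
| RAdd of rexp & rexp
| RSub of rexp & rexp.

Inductive bexp : Type :=
| BEq of nexp & nexp
| BLt of nexp & nexp
| BRLt of rexp & rexp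
| BNot of bexp
| BAnd of bexp & bexp.

Inductive cmd : Type :=
| Skip
| SetN of nat & nexp & nexp   (* SetN a i v is a[i] := v *)
| SetR of nat & nexp & rexp
| Seq of cmd & cmd
| If of bexp & cmd & cmd
| While of bexp & cmd.

Fixpoint ncost (x : nexp) : nat :=
  match x with
  | NConst _ => 1
  | NGet _ i => (ncost i).+1
  | NAdd x y | NSub x y => (ncost x + ncost y).+1
  end.

Fixpoint rcost (x : rexp) : nat :=
  match x with
  | RZero => 1
  | RGet _ i => (ncost i).+1
  | RAdd x y | RSub x y => (rcost x + rcost y).+1
  end.

Fixpoint bcost (b : bexp) : nat :=
  match b with
  | BEq x y | BLt x y => (ncost x + ncost y).+1
  | BRLt x y => (rcost x + rcost y).+1
  | BNot b => (bcost b).+1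
  | BAnd b c => (bcost b + bcost c).+1
  end.

Section Semantics.
Variable R : realType.

Record store : Type := Store {
  nmem : nat -> nat -> nat;
  rmem : nat -> nat -> R
}.

Definition upd (V : Type) (f : nat -> nat -> V) (a i : nat) (v : V) :=
  fun b j => if (b == a) && (j == i) then v else f b j.

Definition setn (s : store) (a i v : nat) : store :=
  Store (upd (nmem s) a i v) (rmem s).

Definition setr (s : store) (a i : nat) (v : R) : store :=
  Store (nmem s) (upd (rmem s) a i v).

Fixpoint neval (s : store) (x : nexp) : nat :=
  match x with
  | NConst k => k
  | NGet a i => nmem s a (neval s i)
  | NAdd x y => (neval s x + neval s y)%N
  | NSub x y => (neval s x - neval s y)%N
  end.

Fixpoint reval (s : store) (x : rexp) : R :=
  match x with
  | RZero => 0
  | RGet a i => rmem s a (neval s i)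
  | RAdd x y => reval s x + reval s y
  | RSub x y => reval s x - reval s y
  end.

Fixpoint beval (s : store) (b : bexp) : bool :=
  match b with
  | BEq x y => neval s x == neval s y
  | BLt x y => (neval s x < neval s y)%N
  | BRLt x y => reval s x < reval s y
  | BNot b => ~~ beval s b
  | BAnd b c => beval s b && beval s c
  end.

(* exec c s t s' : started in s, c terminates in s' after t elementary steps. *)
Inductive exec : cmd -> store -> nat -> store -> Prop :=
| ExecSkip s : exec Skip s 1 s
| ExecSetN s a i x :
    exec (SetN a i x) s (ncost i + ncost x).+1
         (setn s a (neval s i) (neval s x))
| ExecSetR s a i x :
    exec (SetR a i x) s (ncost i + rcost x).+1
         (setr s a (neval s i) (reval s x))
| ExecSeq c1 c2 s s1 s2 t1 t2 :
    exec c1 s t1 s1 -> exec c2 s1 t2 s2 -> exec (Seq c1 c2) s (t1 + t2) s2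
| ExecIf b c1 c2 s s' t :
    exec (if beval s b then c1 else c2) s t s' ->
    exec (If b c1 c2) s (bcost b + t).+1 s'
| ExecWhileF b c s :
    ~~ beval s b -> exec (While b c) s (bcost b).+1 s
| ExecWhileT b c s s1 s2 t1 t2 :
    beval s b -> exec c s t1 s1 -> exec (While b c) s1 t2 s2 ->
    exec (While b c) s (bcost b + t1 + t2).+1 s2.

(* Runs are deterministic, so the existence of a run bounds the running time. *)
Lemma exec_det c s t1 s1 t2 s2 :
  exec c s t1 s1 -> exec c s t2 s2 -> t1 = t2 /\ s1 = s2.
Proof.
move=> H; elim: H t2 s2 => {c s t1 s1}.
- by move=> s t2 s2 H; inversion H.
- by move=> s a i x t2 s2 H; inversion H.
- by move=> s a i x t2 s2 H; inversion H.
- move=> c1 c2 s s1 s2 t1 t2 _ IH1 _ IH2 t' s' H; inversion H; subst.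
  match goal with E : exec c1 _ _ _ |- _ => have [? ?] := IH1 _ _ E end; subst.
  by match goal with E : exec c2 _ _ _ |- _ => have [-> ->] := IH2 _ _ E end.
- move=> b c1 c2 s s' t _ IH t' s2 H; inversion H; subst.
  by match goal with E : exec _ s _ _ |- _ => have [-> ->] := IH _ _ E end.
- move=> b c s /negP nb t' s' H; inversion H; subst => //.
- move=> b c s s1 s2 t1 t2 hb _ IH1 _ IH2 t' s' H; inversion H; subst.
    by match goal with E : is_true (~~ _) |- _ => rewrite hb in E end.
  match goal with E : exec c _ _ _ |- _ => have [? ?] := IH1 _ _ E end; subst.
  by match goal with
     | E : exec (While b c) _ _ _ |- _ => have [-> ->] := IH2 _ _ E
     end.
Qed.

(* Cells outside the given arrays are initialised to 0. *)
Definition load (ns : seq (seq nat)) (rs : seq (seq R)) : store :=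
  Store (fun a i => nth 0%N (nth [::] ns a) i)
        (fun a i => nth 0 (nth [::] rs a) i).

End Semantics.

Section InputOutput.
Variables (R : realType) (n : nat).

(* The order of the vertices inside each adjacency list is arbitrary. *)
Definition adjacency_lists (e : rel 'I_n) (adj : 'I_n -> seq 'I_n) : Prop :=
  forall v, uniq (adj v) /\ adj v =i e v.

Definition block_code (K Mb S : {set 'I_n}) (v : 'I_n) : nat :=
  (if v \in K then 0 else if v \in Mb then 1 else if v \in S then 2 else 3)%N.

(* Natural arrays: 0 holds n; 2 is the concatenation of the adjacency lists   *)
(* of 0, ..., n - 1, the list of v occupying positions off[v] to off[v+1] - 1 *)
(* where off is array 1; 3 gives the block of each vertex.                    *)
(* Real array 0 holds the weights.                                            *)
Definition input (adj : 'I_n -> seq 'I_n) (w : 'I_n -> R)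
    (K Mb S : {set 'I_n}) : store R :=
  load
    [:: [:: n];
        mkseq (fun k => \sum_(v < n | (v < k)%N) size (adj v))%N n.+1;
        flatten [seq [seq val u | u <- adj v] | v <- enum 'I_n];
        [seq block_code K Mb S v | v <- enum 'I_n]]
    [:: [seq w v | v <- enum 'I_n]].

(* The set whose characteristic vector is natural array a. *)
Definition output (a : nat) (s : store R) : {set 'I_n} :=
  [set v : 'I_n | nmem s a v == 1%N].

End InputOutput.

(* Main.v *)
Require Import Defs.
From HB Require Import structures.
From mathcomp Require Import all_boot all_order all_algebra.
From mathcomp Require Import reals.
From mathcomp Require Import zify.

Set Implicit Arguments.
Unset Strict Implicit.
Unset Printing Implicit Defensive.

Import Order.TTheory GRing.Theory Num.Theory.
Local Open Scope ring_scope.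

(** Call the vertices of [K :|: Mb] dense and the others sparse. Two distinct
    sparse vertices are adjacent iff they are partners, two distinct dense
    vertices iff they are not. Hence an independent set contains no dense
    vertex, or one, or a dense vertex and its partner. Once this dense part [X]
    is fixed, the optimal completion consists of the sparse vertices without a
    neighbor in [X] that do not lose against an equally available partner.
    There are O(n) choices of [X], and their values are computed incrementally:
    moving from one to the next only affects the neighbors of [X] and their
    partners, which amounts to O(n + m) updates altogether. Cliques are treated
    by the same program with the two sides exchanged and adjacency negated. The
    partner of a dense vertex is found in time proportional to its degree by
    subtracting the indices of its dense neighbors from the sum of the indices
    of all dense vertices. *)

(** * Running programs *)

Section Programs.
Variable R : realType.
Implicit Types (s : store R) (c d : cmd) (Q : store R -> Prop).
Local Open Scope nat_scope.

(** A total-correctness triple with a time budget. The postcondition is a predicate on stores, so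
    sequencing nests [runs] inside [Q], as with weakest preconditions. *)
Definition runs c s T Q : Prop :=
  exists t s', [/\ exec c s t s', t <= T & Q s'].

Lemma runs_weaken c s T T' (Q Q' : store R -> Prop) :
  runs c s T Q -> T <= T' -> (forall s', Q s' -> Q' s') -> runs c s T' Q'.
Proof.
move=> [t [s' [cs tT Qs']]] TT' QQ'; exists t, s'.
by split=> //; [exact: leq_trans TT' | exact: QQ'].
Qed.

Lemma runs_seq c d s T T' Q :
  runs c s T (fun s' => runs d s' T' Q) -> runs (Seq c d) s (T + T') Q.
Proof.
move=> [t [s1 [cs tT [t' [s2 [ds tT' Q2]]]]]]; exists (t + t'), s2.
by split=> //; [apply: ExecSeq cs ds | apply: leq_add].
Qed.

Lemma runs_if b c d s T Q :
  runs (if beval s b then c else d) s T Q -> runs (If b c d) s (bcost b + T).+1 Q.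
Proof.
move=> [t [s' [cs tT Qs']]]; exists (bcost b + t).+1, s'.
by split=> //; [apply: ExecIf | rewrite ltnS leq_add2l].
Qed.

(** * Straight-line programs, evaluated symbolically *)

Fixpoint straight_line c : bool :=
  match c with
  | Seq c d | If _ c d => straight_line c && straight_line d
  | While _ _ => false
  | _ => true
  end.

Fixpoint denote c s : store R :=
  match c with
  | SetN a i x => setn s a (neval s i) (neval s x)
  | SetR a i x => setr s a (neval s i) (reval s x)
  | Seq c d => denote d (denote c s)
  | If b c d => if beval s b then denote c s else denote d s
  | Skip | While _ _ => s
  end.

(** A time bound for straight-line code only. For a loop it is a coefficient: the doubled test and
    the 10 are tuned so that the [max_cost] of a [for_loop] is its fixed overhead plus the cost of
    one round, to be multiplied by the number of rounds plus one. *)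
Fixpoint max_cost c : nat :=
  match c with
  | Skip => 1
  | While b c => bcost b + bcost b + max_cost c + 10
  | SetN _ i x => (ncost i + ncost x).+1
  | SetR _ i x => (ncost i + rcost x).+1
  | Seq c d => max_cost c + max_cost d
  | If b c d => (bcost b + (max_cost c + max_cost d)).+1
  end.

Lemma runs_straight_line c s Q :
  straight_line c -> Q (denote c s) -> runs c s (max_cost c) Q.
Proof.
elim: c s Q => [|a i x|a i x|c IHc d IHd|b c IHc d IHd|//] s Q /=.
- by move=> _ Qs; exists 1, s; split=> //; constructor.
- by move=> _ Qs; eexists _, _; split; [constructor| |exact: Qs].
- by move=> _ Qs; eexists _, _; split; [constructor| |exact: Qs].
- by case/andP=> slc sld Qs; apply/runs_seq/IHc => //; apply: IHd.
- case/andP=> slc sld Qs; apply: runs_if; case: (beval s b) Qs => Qs.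
    by apply: runs_weaken (IHc _ _ slc Qs) _ _; rewrite ?leq_addr.
  by apply: runs_weaken (IHd _ _ sld Qs) _ _; rewrite ?leq_addl.
Qed.

(** * Frames: the arrays that a program leaves untouched *)

Fixpoint nwrites c : seq nat :=
  match c with
  | SetN a _ _ => [:: a]
  | Seq c d | If _ c d => nwrites c ++ nwrites d
  | While _ c => nwrites c
  | _ => [::]
  end.

Fixpoint rwrites c : seq nat :=
  match c with
  | SetR a _ _ => [:: a]
  | Seq c d | If _ c d => rwrites c ++ rwrites d
  | While _ c => rwrites c
  | _ => [::]
  end.

Fixpoint nreads (x : nexp) : seq nat :=
  match x with
  | NConst _ => [::]
  | NGet a i => a :: nreads i
  | NAdd x y | NSub x y => nreads x ++ nreads y
  end.

Definition frame (N F : seq nat) s s' : Prop :=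
  (forall a i, a \notin N -> nmem s' a i = nmem s a i) /\
  (forall a i, a \notin F -> rmem s' a i = rmem s a i).

Lemma frame_refl N F s : frame N F s s. Proof. by []. Qed.

Lemma frame_trans N F s1 s2 s3 :
  frame N F s1 s2 -> frame N F s2 s3 -> frame N F s1 s3.
Proof.
move=> [n12 r12] [n23 r23]; split=> a i aN; first by rewrite n23 ?n12.
by rewrite r23 ?r12.
Qed.

Lemma frame_sub (N N' F F' : seq nat) s s' :
  {subset N <= N'} -> {subset F <= F'} -> frame N F s s' -> frame N' F' s s'.
Proof.
move=> NN FF [fn fr]; split=> a i aN; [apply: fn | apply: fr].
  by apply: contra aN; apply: NN.
by apply: contra aN; apply: FF.
Qed.

Lemma frame_setn N F s a i v : a \in N -> frame N F s (setn s a i v).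
Proof.
by move=> aN; split=> b j bN //=; rewrite /upd; case: eqP bN => // ->; rewrite aN.
Qed.

Lemma frame_setr N F s a i v : a \in F -> frame N F s (setr s a i v).
Proof.
by move=> aN; split=> b j bN //=; rewrite /upd; case: eqP bN => // ->; rewrite aN.
Qed.

Lemma neval_frame N F s s' x :
  frame N F s s' -> ~~ has [in N] (nreads x) -> neval s' x = neval s x.
Proof.
move=> [fn _]; elim: x => [//|a i IH|x IHx y IHy|x IHx y IHy] /=.
- by rewrite negb_or => /andP[aN iN]; rewrite IH // fn.
- by rewrite has_cat negb_or => /andP[xN yN]; rewrite IHx // IHy.
- by rewrite has_cat negb_or => /andP[xN yN]; rewrite IHx // IHy.
Qed.

Lemma neval_frame_sub (N N' F : seq nat) s s' x :
  frame N F s s' -> all [in N'] N -> ~~ has [in N'] (nreads x) ->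
  neval s' x = neval s x.
Proof.
by move=> fr /allP NN'; apply: (@neval_frame N' F); apply: frame_sub fr.
Qed.

Lemma neval_setr s a i (z : R) x : neval (setr s a i z) x = neval s x.
Proof.
by elim: x => //= [b x ->|x -> y ->|x -> y ->].
Qed.

Lemma exec_frame c s t s' :
  exec c s t s' -> frame (nwrites c) (rwrites c) s s'.
Proof.
elim=> {c s t s'} /=; try by move=> *; exact: frame_refl.
- by move=> s a i x; apply: frame_setn; rewrite mem_head.
- by move=> s a i x; apply: frame_setr; rewrite mem_head.
- move=> c d s s1 s2 _ _ _ fc _ fd; apply: frame_trans (_ : frame _ _ s s1) _.
    by apply: frame_sub fc => a; rewrite mem_cat => ->.
  by apply: frame_sub fd => a; rewrite mem_cat => ->; rewrite orbT.
- move=> b c d s s' _ _; apply: frame_sub => a;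
    by case: (beval s b); rewrite mem_cat => ->; rewrite ?orbT.
- by move=> b c s s1 s2 _ _ _ _ fc _; apply: frame_trans.
Qed.

Lemma runs_frame c s T Q :
  runs c s T Q ->
  runs c s T (fun s' => Q s' /\ frame (nwrites c) (rwrites c) s s').
Proof.
move=> [t [s' [cs tT Qs']]]; exists t, s'; split=> //.
by split=> //; apply: exec_frame cs.
Qed.

(** Lets the second command assume, besides [P], that the first one left everything outside its
    write set intact. *)
Lemma runs_seq_frame c d s T T' (P Q : store R -> Prop) :
  runs c s T P ->
  (forall s', P s' -> frame (nwrites c) (rwrites c) s s' -> runs d s' T' Q) ->
  runs (Seq c d) s (T + T') Q.
Proof.
move=> /runs_frame cs ds; apply: runs_seq; apply: runs_weaken cs _ _ => //.
by move=> s' [Ps' fr]; apply: ds.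
Qed.

(** * Counting loops *)

Definition for_loop (i : nat) (lo hi : nexp) c : cmd :=
  Seq (SetN i (NConst 0) lo)
    (While (BLt (NGet i (NConst 0)) hi)
       (Seq c (SetN i (NConst 0) (NAdd (NGet i (NConst 0)) (NConst 1))))).

Lemma max_cost_for_loop i lo hi c : max_cost (for_loop i lo hi c) =
  ncost lo + ncost hi + 12 + (max_cost c + (ncost hi + 12)).
Proof. by rewrite /=; lia. Qed.

Lemma leq_max_cost_for_loop i lo hi c l h :
  ncost lo + ncost hi + 12 + \sum_(l <= j < h) (max_cost c + (ncost hi + 12)) <=
  max_cost (for_loop i lo hi c) * (h - l).+1.
Proof. by rewrite max_cost_for_loop sum_nat_const_nat; nia. Qed.

(** The budget [T] depends on the index, which later yields sums of degrees instead of products. The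
    bound [hi] is evaluated anew in every round, so it may not read what the loop writes. The
    invariant is imposed after the counter has been advanced, and [l <= h] makes the loop stop
    exactly at [h]. *)
Lemma runs_for_loop i lo hi c s (I : nat -> store R -> Prop) (T : nat -> nat)
    (l := neval s lo) (h := neval s hi) :
  i \notin nwrites c -> ~~ has [in i :: nwrites c] (nreads hi) -> l <= h ->
  I l (setn s i 0 l) ->
  (forall j s', l <= j < h -> nmem s' i 0 = j ->
     frame (i :: nwrites c) (rwrites c) s s' -> I j s' ->
     runs c s' (T j) (fun s'' => I j.+1 (setn s'' i 0 j.+1))) ->
  runs (for_loop i lo hi c) s
    (ncost lo + ncost hi + 12 + \sum_(l <= j < h) (T j + (ncost hi + 12))) (I h).
Proof.
move=> ic hic lh Il step.
suff loop k : forall j s', j + k = h -> l <= j -> nmem s' i 0 = j ->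
    frame (i :: nwrites c) (rwrites c) s s' -> I j s' ->
    runs (While (BLt (NGet i (NConst 0)) hi)
      (Seq c (SetN i (NConst 0) (NAdd (NGet i (NConst 0)) (NConst 1))))) s'
      (ncost hi + 9 + \sum_(j <= j' < h) (T j' + (ncost hi + 12))) (I h).
  rewrite (_ : ncost lo + _ + _ + _ = (1 + ncost lo).+1 +
    (ncost hi + 10 + \sum_(l <= j < h) (T j + (ncost hi + 12)))); last by lia.
  apply: runs_seq; exists (1 + ncost lo).+1, (setn s i 0 l); split=> //.
    exact: ExecSetN.
  apply: runs_weaken (loop (h - l) l _ _ _ _ _ Il) _ _ => //=.
  - by rewrite subnKC.
  - by rewrite /upd !eqxx.
  - by apply: frame_setn; rewrite mem_head.
  - by lia.
elim: k => [|k IH] j s' jk lj s'i fr Ij.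
  rewrite addn0 in jk; rewrite jk in s'i Ij *; eexists _, s'; split; last exact: Ij.
    apply: ExecWhileF; rewrite /= s'i (neval_frame fr) // -/h ltnn //.
  by rewrite /=; lia.
have jh : j < h by lia.
have [t1 [s1 [cs1 t1T [I1 fr1]]]] :=
  runs_frame (step j s' (introT andP (conj lj jh)) s'i fr Ij).
have s1i : nmem s1 i 0 = j by rewrite fr1.1.
have fr2 : frame (i :: nwrites c) (rwrites c) s (setn s1 i 0 j.+1).
  apply: frame_trans fr _; apply: (@frame_trans _ _ _ s1).
    by apply: frame_sub fr1 => // a ac; rewrite inE ac orbT.
  by apply: frame_setn; rewrite mem_head.
have jk' : j.+1 + k = h by rewrite addSnnS.
have s1i' : nmem (setn s1 i 0 j.+1) i 0 = j.+1 by rewrite /= /upd !eqxx.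
have [t2 [s2 [cs2 t2T I2]]] := IH _ _ jk' (leqW lj) s1i' fr2 I1.
have cs3 : exec (SetN i (NConst 0) (NAdd (NGet i (NConst 0)) (NConst 1))) s1
    (1 + (2 + 1).+1).+1 (setn s1 i 0 j.+1).
  rewrite (_ : setn s1 i 0 j.+1 = setn s1 i (neval s1 (NConst 0))
     (neval s1 (NAdd (NGet i (NConst 0)) (NConst 1)))); first exact: ExecSetN.
  by rewrite /= s1i addn1.
have bs' : beval s' (BLt (NGet i (NConst 0)) hi).
  by rewrite /= s'i (neval_frame fr).
exists (bcost (BLt (NGet i (NConst 0)) hi) + (t1 + (1 + (2 + 1).+1).+1) + t2).+1, s2.
split; [exact: ExecWhileT bs' (ExecSeq cs1 cs3) cs2 | | exact: I2].
by rewrite [X in _ <= _ + X]big_ltn //=; lia.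
Qed.

End Programs.

(** * Optimal solutions *)

Section Optimum.
Variables (R : realDomainType) (n : nat) (e : rel 'I_n) (w : 'I_n -> R).
Variables (dense : pred 'I_n) (r : 'I_n -> 'I_n).
Hypotheses (e_sym : symmetric e) (w_gt0 : forall v, 0 < w v).
Hypotheses (rK : involutive r) (dense_r : forall v, dense (r v) = dense v).
Hypothesis e_side : forall u v, u != v -> dense u = dense v ->
  e u v = (if dense u then v != r u else v == r u).
Implicit Types (q : bool) (av : pred 'I_n) (B : {set 'I_n}).

(** For irreflexive [e]: independent sets if [q = false], cliques if [q = true]. Call side [q] the
    set of vertices with [dense v == q]. Distinct vertices there have adjacency [q] unless they are
    partners, those off it adjacency [~~ q] unless they are partners. A fixed point of [r] has no
    partner. *)
Definition homogeneous q B : Prop := {in B &, forall x y, x != y -> e x y = q}.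

(** Ties in weight are broken by index, so of two distinct vertices exactly one beats the other. *)
Definition beats (u v : 'I_n) : bool :=
  (w v < w u) || ~~ (w u < w v) && (u < v)%N.

Lemma beats_asym u v : beats u v -> ~~ beats v u.
Proof. by rewrite /beats; case: ltgtP => //= _; rewrite -leqNgt => /ltnW. Qed.

Lemma beats_total u v : u != v -> beats u v || beats v u.
Proof.
by rewrite /beats -val_eqE /=; case: ltgtP => //= _; rewrite neq_ltn.
Qed.

Lemma beats_le u v : beats u v -> w v <= w u.
Proof. by rewrite /beats; case: ltgtP. Qed.

Definition survivors q av : {set 'I_n} :=
  [set v | [&& dense v == q, av v & ~~ (av (r v) && beats (r v) v)]].

Lemma survivors_dense q av v : v \in survivors q av -> dense v == q.
Proof. by rewrite inE => /and3P[]. Qed.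

(** Only partners could violate homogeneity on side [q], and two available partners cannot both
    survive because one beats the other. *)
Lemma survivors_homogeneous q av : homogeneous q (survivors q av).
Proof.
move=> x y; rewrite !inE => /and3P[/eqP dx avx nx] /and3P[/eqP dy avy ny] xy.
rewrite e_side ?dx // ; have [yr|yr] := eqVneq y (r x); last by case: q {dx dy}.
move: nx ny (beats_total xy).
by rewrite yr rK -yr avx avy /= => /negPf-> /negPf->.
Qed.

(* Sending a non-surviving element to its partner is injective on a homogeneous
   set and does not decrease weights. *)
Lemma survivors_max q av B :
  homogeneous q B -> (forall v, v \in B -> (dense v == q) && av v) ->
  weight w B <= weight w (survivors q av).
Proof.
move=> hB sB; pose f v := if v \in survivors q av then v else r v.
have fB v : v \in B -> (f v \in survivors q av) /\ w v <= w (f v).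
  move=> vB; have /andP[dv avv] := sB v vB; rewrite /f; case: ifPn => [//|].
  rewrite !inE dv avv rK dense_r dv /= negbK => /andP[-> bv] /=.
  by rewrite avv beats_asym //= beats_le.
have f_inj : {in B &, injective f}.
  (* Images can collide only when one element of [B] is the partner of another, and distinct
     partners on side [q] have adjacency [~~ q]. *)
  suff key u v : u \in B -> v \in B -> u = r v -> u = v.
    move=> u v uB vB; rewrite /f; case: ifP => _; case: ifP => _ // eq_uv.
    - exact: key.
    - by apply/esym/key.
    - exact: (can_inj rK).
  move=> uB vB uv; apply/eqP; apply: contraT => nuv.
  have /andP[/eqP du _] := sB u uB; have /andP[/eqP dv _] := sB v vB.
  have := hB _ _ vB uB; rewrite eq_sym => /(_ nuv).
  rewrite e_side ?du ?dv 1?eq_sym // uv eqxx.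
  by case: q {hB sB f fB du dv}.
rewrite /weight.
have -> : \sum_(v in survivors q av) w v =
    \sum_(v in f @: B) w v + \sum_(v in survivors q av :\: f @: B) w v.
  rewrite (big_setID (f @: B)) /=; congr (_ + _); apply: eq_bigl => v.
  by rewrite inE; apply: andb_idl => /imsetP[u uB ->]; case: (fB u uB).
rewrite big_imset //= -[leLHS]addr0 lerD //.
  by apply: ler_sum => v vB; case: (fB v vB).
by apply: sumr_ge0 => v _; rewrite ltW.
Qed.

Definition linked q (x y u : 'I_n) : bool := (e x u == q) && (e y u == q).

(** [Some (x, y)] stands for the part [{x, y}] off side [q], with [x = y] for a single vertex;
    [None] stands for the empty part. *)
Definition solution q (b : option ('I_n * 'I_n)) : {set 'I_n} :=
  if b is Some (x, y) then x |: (y |: survivors q (linked q x y))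
  else survivors q predT.

Definition candidate q (b : option ('I_n * 'I_n)) : bool :=
  if b is Some (x, y) then (dense x != q) && ((y == x) || (y == r x)) else true.

Lemma weight_candidate q x y B :
  candidate q (Some (x, y)) -> (forall v, v \in B -> dense v == q) ->
  weight w (x |: (y |: B)) = weight w B + w x + (if x == y then 0 else w y).
Proof.
move=> /andP[dx xy] sB.
have dy : dense y != q by case/orP: xy => /eqP->; rewrite ?dense_r.
have yB : y \notin B by apply: contra dy; apply: sB.
have xB : x \notin B by apply: contra dx; apply: sB.
case: eqVneq => [<-|nxy].
  by rewrite setUA setUid /weight big_setU1 //= addr0 addrC.
rewrite /weight big_setU1 /= ?inE ?negb_or ?nxy // big_setU1 //=.
by rewrite addrC -addrA addrAC -addrA addrC addrA addrAC.
Qed.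

Lemma solution_homogeneous q b : candidate q b -> homogeneous q (solution q b).
Proof.
case: b => [[x y]|_]; last exact: survivors_homogeneous.
move=> /andP[dx xy] u v; rewrite /solution; set A := survivors _ _.
have exy : x != y -> e x y = q.
  case/orP: xy => /eqP->; first by rewrite eqxx.
  move=> nxr; rewrite e_side ?dense_r // eqxx.
  by case: (q) (dense x) dx => -[].
have sA z : z \in A -> (e x z = q) /\ (e y z = q).
  by rewrite inE => /and3P[_ /andP[/eqP-> /eqP->] _].
rewrite !in_setU1 => /or3P[/eqP->|/eqP->|uA] /or3P[/eqP->|/eqP->|vA] nuv;
  rewrite ?eqxx // in nuv *.
- by case: (sA v vA).
- by rewrite e_sym exy // eq_sym.
- by case: (sA v vA).
- by rewrite e_sym; case: (sA u uA).
- by rewrite e_sym; case: (sA u uA).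
- exact: (survivors_homogeneous uA vA).
Qed.

(** Two distinct vertices of [B] off side [q] must be partners, so [B] meets the other side in a
    candidate part. The rest of [B] is linked to that part and loses no weight when replaced by the
    survivors. *)
Lemma solution_max q B : homogeneous q B ->
  exists2 b, candidate q b & weight w B <= weight w (solution q b).
Proof.
move=> hB; case: (pickP [pred x in B | dense x != q]) => [x|noB]; last first.
  exists None => //; apply: survivors_max hB _ => v vB; rewrite andbT.
  by have /= := noB v; rewrite vB => /negbFE.
case/andP=> /= xB dx; pose y := if r x \in B then r x else x.
have yB : y \in B by rewrite /y; case: ifP.
have cxy : candidate q (Some (x, y)).
  by rewrite /= dx /y; case: ifP; rewrite eqxx ?orbT.
exists (Some (x, y)) => //; pose B' := [set v in B | dense v == q].
have -> : B = x |: (y |: B').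
  apply/setP=> z; rewrite !inE; have [->|zx] /= := eqVneq z x; first exact: xB.
  have [->|zy] /= := eqVneq z y; first exact: yB.
  (* A further vertex [z] off side [q] would be the partner of [x], hence equal to [y]. *)
  rewrite andb_idr // => zB; apply: contraT => dz.
  have dxz : dense x = dense z by case: (q) (dense x) (dense z) dx dz => -[] [].
  have := hB _ _ xB zB; rewrite eq_sym => /(_ zx).
  rewrite e_side 1?eq_sym // => exz; move: zy; rewrite /y.
  have zr : z = r x.
    apply/eqP; rewrite eq_sym; move: dx exz.
    by case: (q); case: (dense x) => // _ /negbFE.
  by rewrite -zr zB eqxx.
rewrite !(weight_candidate cxy); last 2 first.
- by move=> v; apply: survivors_dense.
- by move=> v; rewrite inE => /andP[].
rewrite !lerD2r; apply: survivors_max.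
  by move=> u v; rewrite !inE => /andP[uB _] /andP[vB _]; apply: hB.
move=> v; rewrite inE => /andP[vB dv]; rewrite dv /=.
have dy : dense y != q by rewrite /y; case: ifP; rewrite ?dense_r.
by rewrite /linked !hB ?eqxx //; [apply: contraNneq dy | apply: contraNneq dx] => ->.
Qed.

End Optimum.

(** * Partners in an MT-partition *)

Section Partner.
Variables (n : nat) (e : rel 'I_n) (K Mb S M : {set 'I_n}).
Hypothesis e_sym : symmetric e.
Hypothesis mtP : MT_partition e K Mb S M.

Definition dense (v : 'I_n) : bool := (v \in K) || (v \in Mb).

(** Adjacency opposite to what is typical of the side: adjacent sparse vertices or non-adjacent
    dense ones. *)
Definition exceptional (u v : 'I_n) : bool :=
  [&& u != v, dense u == dense v & e u v != dense u].

(** The default [v] encodes the absence of a partner as a fixed point. *)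
Definition partner (v : 'I_n) : 'I_n := odflt v [pick u | exceptional v u].

Lemma exceptional_sym : symmetric exceptional.
Proof.
move=> u v; rewrite /exceptional eq_sym e_sym [dense v == _]eq_sym.
by case: (dense u =P dense v) => [->|].
Qed.

Lemma induces_matching_uniq (h : rel 'I_n) (A : {set 'I_n}) u v v' :
  induces_matching h A -> u \in A -> v \in A -> v' \in A -> h u v -> h u v' -> v = v'.
Proof.
move=> hA uA vA v'A uv uv'; have /eqP/cards1P[z Az] := hA u uA.
have : v \in [set z] by rewrite -Az inE vA.
have : v' \in [set z] by rewrite -Az inE v'A.
by rewrite !inE => /eqP-> /eqP->.
Qed.

(** Vertices of [K] and [S] are in no exceptional pair: [K] is a clique complete to [Mb], and [S] is
    independent and anticomplete to [M]. This leaves pairs inside [Mb], whose non-edges form a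
    matching, and inside [M], whose edges form one. *)
Lemma exceptional_uniq u v v' : exceptional u v -> exceptional u v' -> v = v'.
Proof.
case: mtP => -[cov dKM dS dM] [[indS indM [h [h_sym h_irr hM eMb]] clK] [SM KMb]].
have cases z : [\/ dense z /\ z \in K, dense z /\ z \in Mb,
    ~~ dense z /\ z \in S | ~~ dense z /\ z \in M].
  have : z \in [set: 'I_n] by rewrite inE.
  rewrite -cov !inE /dense.
  have := disjointFr dM (x := z); have := disjointFr dS (x := z); rewrite !inE.
  case: (z \in K) (z \in Mb) (z \in S) (z \in M) => -[] [] [] //=;
    do ?[by move=> /(_ erefl)]; do ?[by move=> _ /(_ erefl)] => _ _ _;
    by [apply: Or41 | apply: Or42 | apply: Or43 | apply: Or44].
have exM x z : exceptional x z -> x \in Mb ->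
    [/\ z \in Mb & h x z].
  move=> /and3P[xz /eqP dxz exz] xM; have dx : dense x by rewrite /dense xM orbT.
  rewrite dx in exz; case: (cases z) => -[dz zI].
  - by rewrite e_sym KMb in exz.
  - by rewrite eMb // xz /= in exz; case: (h x z) exz.
  - by rewrite -dxz dx in dz.
  - by rewrite -dxz dx in dz.
have exS x z : exceptional x z -> x \in M -> ~~ dense x -> z \in M /\ e x z.
  move=> /and3P[xz /eqP dxz exz] xM ndx; rewrite (negPf ndx) in dxz exz.
  have exz' : e x z by case: (e x z) exz.
  case: (cases z) => -[dz zI]; rewrite -?dxz // in dz.
  by have := SM _ _ zI xM; rewrite e_sym exz'.
move=> uv uv'; case: (cases u) => -[du uI].
- suff: ~~ exceptional u v by rewrite uv.
  apply/negP=> /and3P[nuv /eqP duv]; rewrite du; case: (cases v) => -[dv vI].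
  + by rewrite clK.
  + by rewrite KMb.
  + by rewrite -duv du in dv.
  + by rewrite -duv du in dv.
- have [vI huv] := exM _ _ uv uI; have [v'I huv'] := exM _ _ uv' uI.
  exact: induces_matching_uniq hM uI vI v'I huv huv'.
- suff: ~~ exceptional u v by rewrite uv.
  apply/negP=> /and3P[nuv /eqP duv]; rewrite (negPf du); case: (cases v) => -[dv vI].
  + by rewrite -duv (negPf du) in dv.
  + by rewrite -duv (negPf du) in dv.
  + by rewrite (negPf (indS _ _ uI vI)).
  + by rewrite (negPf (SM _ _ uI vI)).
- have [vI huv] := exS _ _ uv uI du; have [v'I huv'] := exS _ _ uv' uI du.
  exact: induces_matching_uniq indM uI vI v'I huv huv'.
Qed.

Lemma exceptional_partner u v : exceptional u v = (u != v) && (v == partner u).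
Proof.
rewrite /partner; case: pickP => [z uz|none] /=.
  apply/idP/andP => [uv|[_ /eqP->] //]; split; first by case/and3P: uv.
  by rewrite (exceptional_uniq uv uz).
by rewrite none [v == u]eq_sym andNb.
Qed.

Lemma dense_partner v : dense (partner v) = dense v.
Proof. by rewrite /partner; case: pickP => [u /and3P[_ /eqP]|]. Qed.

Lemma partnerK : involutive partner.
Proof.
move=> v; have [vp|nvp] := eqVneq v (partner v); first by rewrite -!vp.
have: exceptional v (partner v) by rewrite exceptional_partner nvp eqxx.
by rewrite exceptional_sym exceptional_partner => /andP[_ /eqP].
Qed.

(** Provides the hypothesis [e_side] of the optimisation argument. *)
Lemma edge_same_side u v : u != v -> dense u = dense v ->
  e u v = (if dense u then v != partner u else v == partner u).
Proof.
move=> uv duv; have := exceptional_partner u v.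
by rewrite /exceptional uv duv eqxx /= => <-; case: (dense v) (e u v) => -[].
Qed.

End Partner.

(** The lists enumerate the ordered adjacent pairs, and at most two of these have the same
    underlying edge. *)
Lemma leq_sum_deg n (e : rel 'I_n) (adj : 'I_n -> seq 'I_n) :
  adjacency_lists e adj ->
  (\sum_(v < n) size (adj v) <= 2 * #|edges e|)%N.
Proof.
move=> adjP; pose E : {set 'I_n * 'I_n} := [set p | e p.1 p.2].
have -> : (\sum_(v < n) size (adj v) = #|E|)%N.
  rewrite -sum1_card (eq_bigl (fun p => xpredT p.1 && e p.1 p.2)); last first.
    by move=> p; rewrite inE.
  rewrite -(pair_big_dep xpredT (fun v u => e v u) (fun _ _ => 1%N)) /=.
  apply: eq_bigr => v _; have [uv av] := adjP v.
  by rewrite sum1_card -(card_uniqP uv); apply: eq_card.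
rewrite -sum1_card (partition_big_imset (fun p => [set p.1; p.2])) /=.
rewrite -/(edges e) mulnC -sum_nat_const.
have -> : edges e = [set [set p.1; p.2] | p in E].
  by apply/setP=> A; apply/imsetP/imsetP => -[p pE ->]; exists p => //;
    rewrite !inE in pE *.
apply: leq_sum => A /imsetP[[a b] _ ->]; rewrite sum1_card.
apply: leq_trans (_ : #|[set (a, b); (b, a)]| <= 2)%N; last first.
  by rewrite cards2; case: (_ != _).
apply/subset_leq_card/subsetP=> -[c d]; rewrite !inE /= => /andP[_ /eqP cd].
have := set21 c d; have := set22 c d; rewrite cd !inE.
have := set21 a b; have := set22 a b; rewrite -cd !inE !xpair_eqE.
by move=> /orP[]/eqP-> /orP[]/eqP-> /orP[]/eqP-> /orP[]/eqP->; rewrite !eqxx ?orbT.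
Qed.

(** * The program *)

(* Natural arrays: 6 partners, 7 counters, 8 current selection, 10 and 9 inner
   and outer loop indices, 11 the vertex being updated, 13 and 14 the best
   candidate so far (13 holds [n] for the empty one), 16 and 17 sums of indices
   shifted by one, so that 0 stands for the absence of a partner. Real arrays:
   1 weight of the selection, 2 best value, 3 value of the current candidate. *)
Section Macros.
Local Open Scope nat_scope.
Implicit Types (q : bool) (x y m lo hi src : nexp) (b : bexp).

Definition cell a : nexp := NGet a (NConst 0).
Definition rcell a : rexp := RGet a (NConst 0).
Definition bor b1 b2 : bexp := BNot (BAnd (BNot b1) (BNot b2)).

Definition dense_test x : bexp := BLt (NGet 3 x) (NConst 2).

Definition side_test q x : bexp :=
  if q then dense_test x else BNot (dense_test x).

Definition same_side_test x y : bexp :=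
  bor (BAnd (dense_test x) (dense_test y))
      (BAnd (BNot (dense_test x)) (BNot (dense_test y))).

Definition beats_test x y : bexp :=
  bor (BRLt (RGet 0 y) (RGet 0 x))
      (BAnd (BNot (BRLt (RGet 0 x) (RGet 0 y))) (BLt x y)).

Definition available_test q x : bexp := BEq (NGet 7 x) (NConst q.+1).

Definition survivor_test q x : bexp :=
  BAnd (side_test q x) (BAnd (available_test q x)
    (BNot (BAnd (available_test q (NGet 6 x)) (beats_test (NGet 6 x) x)))).

Definition refresh q x : cmd :=
  If (survivor_test q x)
    (If (BEq (NGet 8 x) (NConst 1)) Skip
       (Seq (SetR 1 (NConst 0) (RAdd (rcell 1) (RGet 0 x))) (SetN 8 x (NConst 1))))
    (If (BEq (NGet 8 x) (NConst 1))
       (Seq (SetR 1 (NConst 0) (RSub (rcell 1) (RGet 0 x))) (SetN 8 x (NConst 0)))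
       Skip).

(** Changing the counter of a vertex can alter the survival of that vertex and of its partner only,
    so two refreshes restore the selection. *)
Definition touch q m : cmd :=
  Seq (SetN 7 (cell 11) m)
    (Seq (refresh q (cell 11)) (refresh q (NGet 6 (cell 11)))).

Definition visit q lo hi src m : cmd :=
  for_loop 10 lo hi (Seq (SetN 11 (NConst 0) src) (touch q m)).

Definition visit_all q k : cmd :=
  visit q (NConst 0) (cell 0) (cell 10) (NConst k).

Definition visit_neighbors q x m : cmd :=
  visit q (NGet 1 x) (NGet 1 (NAdd x (NConst 1))) (NGet 2 (cell 10)) m.

Definition incr_count : nexp := NAdd (NGet 7 (cell 11)) (NConst 1).
Definition decr_count : nexp := NSub (NGet 7 (cell 11)) (NConst 1).

Definition record_candidate x y : cmd :=
  Seq (If (BEq x y)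
         (SetR 3 (NConst 0) (RAdd (rcell 1) (RGet 0 x)))
         (SetR 3 (NConst 0) (RAdd (RAdd (rcell 1) (RGet 0 x)) (RGet 0 y))))
    (If (BRLt (rcell 2) (rcell 3))
       (Seq (SetR 2 (NConst 0) (rcell 3))
          (Seq (SetN 13 (NConst 0) x) (SetN 14 (NConst 0) y)))
       Skip).

(** For [x = y] the neighbors are counted twice, so the same counter value signals availability for
    single vertices and for pairs. The decrements restore the counters at a similar cost. *)
Definition try_candidate q x y : cmd :=
  Seq (visit_neighbors q x incr_count) (Seq (visit_neighbors q y incr_count)
    (Seq (record_candidate x y)
      (Seq (visit_neighbors q x decr_count) (visit_neighbors q y decr_count)))).

Definition clear_counts : cmd :=
  Seq (for_loop 10 (NConst 0) (cell 0)
         (Seq (SetN 7 (cell 10) (NConst 0)) (SetN 8 (cell 10) (NConst 0))))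
      (SetR 1 (NConst 0) RZero).

Definition try_all q : cmd :=
  for_loop 9 (NConst 0) (cell 0)
    (If (side_test (~~ q) (cell 9))
       (Seq (try_candidate q (cell 9) (cell 9))
            (try_candidate q (cell 9) (NGet 6 (cell 9))))
       Skip).

Definition select_best q : cmd :=
  If (BLt (cell 13) (cell 0))
    (Seq (visit_neighbors q (cell 13) incr_count)
      (Seq (visit_neighbors q (cell 14) incr_count)
        (Seq (SetN 8 (cell 13) (NConst 1)) (SetN 8 (cell 14) (NConst 1)))))
    (visit_all q q.+1).

Definition copy_out a : cmd :=
  for_loop 10 (NConst 0) (cell 0) (SetN a (cell 10) (NGet 8 (cell 10))).

(** With counters 0 nothing is available, with counters [q.+1] everything is, which gives the value
    of the empty candidate. The search then starts from counters [~~ q]. Results go to array 4 for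
    independent sets and to array 5 for cliques. *)
Definition solve q : cmd :=
  Seq clear_counts (Seq (visit_all q q.+1)
    (Seq (Seq (SetR 2 (NConst 0) (rcell 1)) (SetN 13 (NConst 0) (cell 0)))
      (Seq (visit_all q (~~ q)) (Seq (try_all q)
        (Seq (select_best q) (copy_out (4 + q))))))).

Definition sum_vertices lo hi src b : cmd :=
  for_loop 10 lo hi
    (If b (SetN 16 (NConst 0) (NAdd (cell 16) (NAdd src (NConst 1)))) Skip).

(** With indices shifted by one, cell 17 holds the sum over all dense vertices and cell 16 the sum
    over the neighbors on the side of [x]; for sparse [x] the latter already is the partner. *)
Definition find_partner x : cmd :=
  Seq (If (dense_test x)
         (SetN 16 (NConst 0)
            (NSub (NSub (cell 17) (cell 16)) (NAdd x (NConst 1))))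
         Skip)
    (If (BEq (cell 16) (NConst 0)) (SetN 6 x x)
       (SetN 6 x (NSub (cell 16) (NConst 1)))).

Definition find_partners : cmd :=
  Seq (SetN 16 (NConst 0) (NConst 0))
  (Seq (sum_vertices (NConst 0) (cell 0) (cell 10) (dense_test (cell 10)))
  (Seq (SetN 17 (NConst 0) (cell 16))
    (for_loop 9 (NConst 0) (cell 0)
      (Seq (SetN 16 (NConst 0) (NConst 0))
        (Seq (sum_vertices (NGet 1 (cell 9)) (NGet 1 (NAdd (cell 9) (NConst 1)))
                (NGet 2 (cell 10)) (same_side_test (cell 9) (NGet 2 (cell 10))))
          (find_partner (cell 9))))))).

Definition mt_program : cmd :=
  Seq find_partners (Seq (solve false) (solve true)).

End Macros.

(** * Correctness and running time of the program *)

Section Algorithm.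
Variables (R : realType) (n : nat) (e : rel 'I_n) (adj : 'I_n -> seq 'I_n).
Variables (w : 'I_n -> R) (dense : pred 'I_n) (r : 'I_n -> 'I_n).
Hypotheses (e_sym : symmetric e) (adjP : adjacency_lists e adj).
Hypotheses (w_gt0 : forall v, 0 < w v).
Hypotheses (rK : involutive r) (dense_r : forall v, dense (r v) = dense v).
Hypothesis e_side : forall u v, u != v -> dense u = dense v ->
  e u v = (if dense u then v != r u else v == r u).
Implicit Types (s : store R) (q : bool) (c : 'I_n -> nat) (x y : nexp).

(** Only natural arrays 0 to 3 and real array 0 are involved, so this is preserved by any command
    that writes elsewhere. *)
Record graph_input s : Prop := GraphInput {
  input_size : nmem s 0 0 = n;
  input_offset : forall v : 'I_n, nmem s 1 v.+1 = (nmem s 1 v + size (adj v))%N;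
  input_neighbor : forall (v u0 : 'I_n) i, (i < size (adj v))%N ->
    nmem s 2 (nmem s 1 v + i) = nth u0 (adj v) i;
  input_dense : forall v : 'I_n, (nmem s 3 v < 2)%N = dense v;
  input_weight : forall v : 'I_n, rmem s 0 v = w v
}.

Definition ready s : Prop :=
  graph_input s /\ forall v : 'I_n, nmem s 6 v = r v.

Lemma graph_input_frame N F s s' : frame N F s s' ->
  all (fun a => a \notin N) (iota 0 4) -> 0%N \notin F ->
  graph_input s -> graph_input s'.
Proof.
move=> [fn fr] /and5P[N0 N1 N2 N3 _] F0 [i0 i1 i2 i3 iw]; split=> *;
  rewrite ?fn ?fr //; by [apply: i1 | apply: i2 | apply: i3 | apply: iw].
Qed.

Lemma ready_frame N F s s' : frame N F s s' ->
  all (fun a => a \notin N) [:: 0; 1; 2; 3; 6]%N -> 0%N \notin F ->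
  ready s -> ready s'.
Proof.
move=> fr /and5P[N0 N1 N2 N3 /andP[N6 _]] F0 [gi rs]; split.
  by apply: graph_input_frame fr _ F0 gi; rewrite /= N0 N1 N2 N3.
by move=> v; rewrite fr.1.
Qed.

Lemma beval_bor s (b1 b2 : bexp) : beval s (bor b1 b2) = beval s b1 || beval s b2.
Proof. by rewrite /= negb_and !negbK. Qed.

Lemma beval_side_test s q x (v : 'I_n) : graph_input s -> neval s x = v ->
  beval s (side_test q x) = (dense v == q).
Proof. by move=> gi xv; case: q; rewrite /= xv input_dense //; case: dense. Qed.

Lemma beval_same_side_test s x y (u v : 'I_n) : graph_input s ->
  neval s x = u -> neval s y = v ->
  beval s (same_side_test x y) = (dense u == dense v).
Proof.
move=> gi xu yv; rewrite beval_bor /= xu yv !input_dense //.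
by case: (dense u); case: (dense v).
Qed.

Lemma beval_beats_test s x y (u v : 'I_n) : graph_input s ->
  neval s x = u -> neval s y = v -> beval s (beats_test x y) = beats w u v.
Proof. by move=> gi xu yv; rewrite beval_bor /= xu yv !input_weight. Qed.

(* Trying a candidate [(x, y)] raises the counters of the neighbors of [x] and of
   [y] by one each, starting from [~~ q]. So reaching exactly [q.+1] means being
   adjacent to both when [q] is true (cliques), to neither when [q] is false. *)
Definition counted q c : pred 'I_n := fun v => c v == q.+1.

Lemma beval_survivor_test s q c x (v : 'I_n) : ready s ->
  (forall u : 'I_n, nmem s 7 u = c u) -> neval s x = v ->
  beval s (survivor_test q x) = (v \in survivors w dense r q (counted q c)).
Proof.
move=> [gi rs] cs xv; rewrite inE [LHS]/= (beval_side_test _ gi xv).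
rewrite -(beval_beats_test gi _ xv (x := NGet 6 x) (u := r v)) ?[neval _ _]/= ?xv ?rs //.
by rewrite /= xv rs !cs.
Qed.

(** * Incremental maintenance of the selection *)

Lemma output_setn a s (v : 'I_n) k : output n a (setn s a v k) =
  if k == 1%N then v |: output n a s else output n a s :\ v.
Proof.
apply/setP=> u; rewrite inE /= /upd eqxx /= val_eqE.
by case: (eqVneq k); rewrite !inE; case: (eqVneq u) => //= _; [move=> -> | move/negPf].
Qed.

Lemma refresh_spec s q c x (v : 'I_n) : ready s ->
  (forall u : 'I_n, nmem s 7 u = c u) -> neval s x = v ->
  rmem s 1 0 = weight w (output n 8 s) ->
  runs (refresh q x) s (max_cost (refresh q x)) (fun s' =>
    output n 8 s' = (if v \in survivors w dense r q (counted q c)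
                     then v |: output n 8 s else output n 8 s :\ v) /\
    rmem s' 1 0 = weight w (output n 8 s')).
Proof.
move=> rs cs xv ws; apply: runs_straight_line => //.
rewrite /refresh /denote -/denote (beval_survivor_test q rs cs xv).
have sel : beval s (BEq (NGet 8 x) (NConst 1)) = (v \in output n 8 s).
  by rewrite inE /= xv.
rewrite sel; have wv := input_weight rs.1 v.
case: ifP => _; case: ifPn => vO.
- by split=> //; apply/esym/setUidPr; rewrite sub1set.
- rewrite neval_setr xv output_setn; split=> //=.
  by rewrite /upd /= ws xv wv /weight big_setU1 //= addrC.
- rewrite neval_setr xv output_setn; split=> //=.
  by rewrite /upd /= ws xv wv /weight [in LHS](big_setD1 v) //= addrAC subrr add0r.
- split=> //; apply/setP=> u; rewrite in_setD1.
  by case: eqVneq => // ->; apply/negbTE.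
Qed.

(** Invariant of the incremental computation. The counters enter as a function [c], so that a
    command can be specified by its effect on [c] alone. *)
Definition consistent q c s : Prop :=
  [/\ forall v : 'I_n, nmem s 7 v = c v,
      output n 8 s = survivors w dense r q (counted q c)
    & rmem s 1 0 = weight w (output n 8 s)].

Lemma consistent_frame N F s s' q c : frame N F s s' ->
  7 \notin N -> 8 \notin N -> 1%N \notin F -> consistent q c s -> consistent q c s'.
Proof.
move=> [fn fr] N7 N8 F1 [cs os ws].
have os' : output n 8 s' = output n 8 s by apply/setP=> v; rewrite !inE fn.
by split=> [v||]; rewrite ?fn ?os' ?fr.
Qed.

Lemma eq_consistent s q c c' : c =1 c' -> consistent q c s -> consistent q c' s.
Proof.
move=> cc' [cs os ws]; split=> // [v|]; first by rewrite cs cc'.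
by rewrite os; apply/setP=> v; rewrite !inE /counted !cc'.
Qed.

Lemma touch_spec s q c (m : nexp) (u : 'I_n) : ready s -> consistent q c s ->
  nmem s 11 0 = u ->
  runs (touch q m) s (max_cost (touch q m))
    (consistent q (fun v => if v == u then neval s m else c v)).
Proof.
move=> rs [cs os ws] su; set c' := fun v : 'I_n => _.
apply: runs_seq_frame; first exact: (runs_straight_line (Q := eq _)).
move=> _ <-; rewrite [denote _ _]/= su => fr1; set s1 := setn _ _ _ _.
have rs1 : ready s1 by apply: ready_frame fr1 _ _ rs.
have cs1 (v : 'I_n) : nmem s1 7 v = c' v.
  by rewrite /= /upd eqxx val_eqE cs.
have ws1 : rmem s1 1 0 = weight w (output n 8 s1) by [].
have su1 : neval s1 (cell 11) = u by [].
apply: runs_seq_frame; first exact: (refresh_spec q rs1 cs1 su1 ws1).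
move=> s2 [os2 ws2] fr2.
have rs2 : ready s2 by apply: ready_frame fr2 _ _ rs1.
have cs2 (v : 'I_n) : nmem s2 7 v = c' v by rewrite fr2.1.
have s2u : nmem s2 11 0 = u by rewrite fr2.1.
have su2 : neval s2 (NGet 6 (cell 11)) = r u by rewrite /= s2u rs2.2.
apply: runs_weaken (runs_frame (refresh_spec q rs2 cs2 su2 ws2)) _ _ => //.
move=> s3 [[os3 ws3] fr3]; split=> // [v|]; first by rewrite fr3.1.
have os1 : output n 8 s1 = output n 8 s by [].
rewrite os3 os2 os1 os.
pose A := survivors w dense r q (counted q c'); rewrite -/A.
have EA : A = survivors w dense r q (counted q c') by [].
clearbody A; apply/setP=> v.
have [->|vu] := eqVneq v u.
  have [ru|nru] := eqVneq (r u) u.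
    by rewrite ru; case: ifP => uA; rewrite !(in_setU1, in_setD1) eqxx.
  by case: ifP => ruA; case: ifP => uA; rewrite !(in_setU1, in_setD1) eqxx /=
    ?orbT ?andbF // eq_sym (negPf nru).
have [->|vru] := eqVneq v (r u); first by case: ifP => ?; rewrite !inE eqxx.
(* For any other vertex neither its counter nor that of its partner has changed, so its survival is
   as before. *)
transitivity (v \in survivors w dense r q (counted q c)).
  by do 2![case: ifP => _]; rewrite !inE (negPf vu) (negPf vru).
have rvu : r v != u by apply: contra vru => /eqP<-; rewrite rK.
by rewrite EA !inE /counted /c' (negPf vu) (negPf rvu).
Qed.


Lemma consistent_setn s q c a i k : a != 7 -> a != 8 ->
  consistent q c s -> consistent q c (setn s a i k).
Proof.
move=> a7 a8; apply: (@consistent_frame [:: a] [::]) => //.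
- by apply: frame_setn; rewrite mem_head.
- by rewrite inE eq_sym.
- by rewrite inE eq_sym.
Qed.

(** Common form of the passes over all vertices and over one adjacency list: [l] is the list
    traversed, [g] the effect of [m] on a counter. *)
Lemma visit_spec q lo hi src (m : nexp) s c (l : seq 'I_n) (g : nat -> nat) :
  ready s -> consistent q c s -> uniq l ->
  neval s hi = (neval s lo + size l)%N ->
  ~~ has [in [:: 7; 8; 10; 11]%N] (nreads hi) ->
  (forall s' u0 i, frame [:: 7; 8; 10; 11]%N [:: 1%N] s s' -> (i < size l)%N ->
     nmem s' 10 0 = (neval s lo + i)%N -> neval s' src = nth u0 l i) ->
  (forall s' (u : 'I_n), nmem s' 11 0 = u -> neval s' m = g (nmem s' 7 u)) ->
  runs (visit q lo hi src m) s (max_cost (visit q lo hi src m) * (size l).+1)%N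
    (consistent q (fun v => if v \in l then g (c v) else c v)).
Proof.
move=> rs Qs ul hiE hi_fr srcE mE.
set body := Seq (SetN 11 (NConst 0) src) (touch q m).
pose I j := consistent q (fun v =>
  if v \in take (j - neval s lo) l then g (c v) else c v).
have frW s' : frame (10%N :: nwrites body) (rwrites body) s s' ->
    frame [:: 7; 8; 10; 11]%N [:: 1%N] s s'.
  by apply: frame_sub; apply/allP.
apply: runs_weaken (runs_for_loop (I := I)
  (T := fun=> max_cost body) _ _ _ _ _) _ _.
- by [].
- apply: contra hi_fr; apply: sub_has; apply/allP => //.
- by rewrite hiE leq_addr.
- apply: eq_consistent (consistent_setn _ _ _ _ Qs) => // v.
  by rewrite subnn take0.
- move=> j s' /andP[lj jh] s'j /frW fr Ij.
  have [i jE] : exists i, j = (neval s lo + i)%N.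
    by exists (j - neval s lo)%N; rewrite subnKC.
  rewrite {}jE in lj jh s'j Ij *; rewrite hiE ltn_add2l in jh.
  have [u0 _] : exists u0 : 'I_n, u0 \in l.
    by case: (l) jh => // a *; exists a; rewrite mem_head.
  have src_u := srcE s' u0 i fr jh s'j; set u := nth u0 l i in src_u.
  apply: runs_seq_frame; first exact: (runs_straight_line (Q := eq _)).
  move=> _ <-; rewrite [denote _ _]/= src_u => fr1.
  set s1 := setn _ _ _ _.
  have rs1 : ready s1.
    by apply: ready_frame fr1 _ _ (ready_frame fr _ _ rs).
  have Q1 := consistent_frame fr1 isT isT isT Ij.
  have s1u : nmem s1 11 0 = u by rewrite /= /upd !eqxx.
  apply: runs_weaken (touch_spec m rs1 Q1 s1u) _ _ => //.
  move=> s2 Q2; rewrite /I -addnS.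
  apply: eq_consistent (consistent_setn _ _ _ _ Q2) => // v.
  rewrite !addKn (take_nth u0) // mem_rcons inE -/u.
  have [->|//] := eqVneq v u; rewrite (mE s1 u) //; case: Q1 => -> _ _.
  (* By uniqueness [u] is absent from the prefix already treated, so its counter is still [c u]. *)
  rewrite addKn ifN //; move: ul.
  rewrite -{1}(cat_take_drop i l) (drop_nth u0) // cat_uniq => /and3P[_ + _].
  by rewrite /= negb_or => /andP[].
- by apply: leq_trans (leq_max_cost_for_loop 10 _ _ _ _ _) _; rewrite hiE addKn.
- by move=> s'; rewrite /I hiE addKn take_size.
Qed.

Lemma visit_all_spec q k s c : ready s -> consistent q c s ->
  runs (visit_all q k) s (max_cost (visit_all q k) * n.+1)%N (consistent q (fun=> k)).
Proof.
move=> rs Qs; have := @visit_spec q (NConst 0) (cell 0) (cell 10) (NConst k)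
  s c (enum 'I_n) (fun=> k) rs Qs (enum_uniq _).
rewrite size_enum_ord => /(_ (input_size rs.1) isT) run.
apply: runs_weaken (run _ _) _ _ => //.
  by move=> s' u0 i _ ilt /= ->; rewrite nth_enum_ord.
by move=> s'; apply: eq_consistent => v; rewrite mem_enum.
Qed.

Lemma visit_neighbors_spec q x (m : nexp) s c (v : 'I_n) (g : nat -> nat) :
  ~~ has [in [:: 7; 8; 10; 11]%N] (nreads x) ->
  ready s -> consistent q c s -> neval s x = v ->
  (forall s' (u : 'I_n), nmem s' 11 0 = u -> neval s' m = g (nmem s' 7 u)) ->
  runs (visit_neighbors q x m) s
    (max_cost (visit_neighbors q x m) * (size (adj v)).+1)%N
    (consistent q (fun u => if e v u then g (c u) else c u)).
Proof.
move=> x_fr rs Qs xv mE; have [uv av] := adjP v.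
apply: runs_weaken (visit_spec rs Qs uv _ _ _ mE) (leqnn _) _.
- by rewrite /= xv addn1 (input_offset rs.1).
- by rewrite /= cats0.
- move=> s' u0 i fr ilt /= ->; rewrite xv.
  by rewrite fr.1 // (input_neighbor rs.1 u0 ilt).
- by move=> s'; apply: eq_consistent => u; rewrite av.
Qed.

(** * Search for the best candidate *)

Definition encodes (b : option ('I_n * 'I_n)) s : Prop :=
  if b is Some (x, y) then nmem s 13 0 = x /\ nmem s 14 0 = y
  else nmem s 13 0 = n.

(** The recorded candidate need not lie in [D], which only collects those it is known to
    dominate. *)
Definition best q (D : pred (option ('I_n * 'I_n))) s : Prop :=
  exists b, [/\ candidate dense r q b, encodes b s,
    rmem s 2 0 = weight w (solution e w dense r q b)
    & forall b', candidate dense r q b' -> D b' ->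
        weight w (solution e w dense r q b') <= rmem s 2 0].

Lemma best_frame N F s s' q D : frame N F s s' ->
  13 \notin N -> 14 \notin N -> 2 \notin F -> best q D s -> best q D s'.
Proof.
move=> [fn fr] N13 N14 F2 [b [cb eb wb mb]]; exists b; split=> //.
- by case: b {cb wb} eb => [[x y]|] /=; rewrite !fn.
- by rewrite fr.
- by move=> b' cb' Db'; rewrite fr //; apply: mb.
Qed.

Lemma sub_best q (D D' : pred (option ('I_n * 'I_n))) s :
  (forall b, candidate dense r q b -> D' b -> D b) -> best q D s -> best q D' s.
Proof.
by move=> DD [b [cb eb wb mb]]; exists b; split=> // b' cb' /DD-/(_ cb'); apply: mb.
Qed.

(** Cell 13 is overwritten before [y] is evaluated for cell 14, whence the condition on [y]. *)
Lemma record_candidate_spec s q x y (u v : 'I_n) D : graph_input s ->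
  neval s x = u -> neval s y = v -> 13 \notin nreads y ->
  candidate dense r q (Some (u, v)) ->
  rmem s 1 0 = weight w (survivors w dense r q (linked e q u v)) ->
  best q D s ->
  runs (record_candidate x y) s (max_cost (record_candidate x y))
    (best q [predU1 Some (u, v) & D]).
Proof.
move=> gi xu yv y13 cuv tot [b [cb eb wb mb]].
have wuv : weight w (solution e w dense r q (Some (u, v))) =
    rmem s 1 0 + w u + (if u == v then 0 else w v).
  rewrite [solution _ _ _ _ _ _]/= (weight_candidate w dense_r cuv) ?tot //.
  by move=> z; apply: survivors_dense.
pose s1 := setr s 3 0 (weight w (solution e w dense r q (Some (u, v)))).
apply: (runs_seq_frame (P := eq s1)).
  apply: runs_straight_line => //; rewrite /s1 wuv /= xu yv val_eqE.
  by case: ifP => _ /=; rewrite ?xu ?yv !(input_weight gi) // addr0.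
move=> _ <- _; apply: runs_straight_line => //.
have y_fr : ~~ has [in [:: 13%N]] (nreads y).
  by rewrite has_sym /= orbF.
have neval1 z : neval (setr s1 2 0 (rmem s1 3 0)) z = neval s z.
  by rewrite !neval_setr.
have neval2 : neval (setn (setr s1 2 0 (rmem s1 3 0)) 13 0 u) y = v.
  have fr : frame [:: 13%N] [::] (setr s1 2 0 (rmem s1 3 0))
      (setn (setr s1 2 0 (rmem s1 3 0)) 13 0 u) by apply: frame_setn.
  by rewrite (neval_frame fr y_fr) neval1.
have s1_2 : rmem s1 2 0 = rmem s 2 0 by [].
have s1_3 : rmem s1 3 0 = weight w (solution e w dense r q (Some (u, v))).
  by rewrite /= /upd eqxx.
have eb1 : encodes b s1 by [].
clearbody s1; rewrite /= s1_2 s1_3; case: ltP => [lt|le]; last first.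
  exists b; split; rewrite ?s1_2 // => b' cb'.
  by case/orP=> [/eqP->|Db']; [apply: le | apply: mb].
exists (Some (u, v)); rewrite -s1_3 neval1 xu neval2; split=> // b' cb'.
rewrite [rmem _ _ _]/= /upd !eqxx s1_3 /= => /orP[/eqP->//|Db'].
by apply: le_trans (ltW lt); apply: mb.
Qed.

Lemma incr_countE s (u : 'I_n) :
  nmem s 11 0 = u -> neval s incr_count = (nmem s 7 u).+1.
Proof. by move=> /= ->; rewrite addn1. Qed.

Lemma decr_countE s (u : 'I_n) :
  nmem s 11 0 = u -> neval s decr_count = (nmem s 7 u).-1.
Proof. by move=> /= ->; rewrite subn1. Qed.

(** The nested conditionals result from two successive passes of increments, over the neighbors of
    [u] and then over those of [v]. *)
Lemma consistent_linked s q (u v : 'I_n) :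
  consistent q (fun z => if e v z then (if e u z then (~~ q).+1 else ~~ q).+1
                         else if e u z then (~~ q).+1 else ~~ q)%N s ->
  output n 8 s = survivors w dense r q (linked e q u v).
Proof.
case=> _ -> _; apply/setP=> z; rewrite !inE /counted /linked.
by case: (q); case: (e v z); case: (e u z); case: (e v _); case: (e u _).
Qed.

Lemma try_candidate_spec q x y s (u v : 'I_n) D :
  ~~ has [in [:: 7; 8; 10; 11; 13; 14]%N] (nreads x ++ nreads y) ->
  ready s -> consistent q (fun=> ~~ q) s -> neval s x = u -> neval s y = v ->
  candidate dense r q (Some (u, v)) -> best q D s ->
  runs (try_candidate q x y) s
    (max_cost (try_candidate q x y) * (size (adj u) + size (adj v)).+1)%N
    (fun s' => consistent q (fun=> ~~ q) s' /\ best q [predU1 Some (u, v) & D] s').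
Proof.
rewrite has_cat negb_or => /andP[x_fr y_fr].
have x_fr' : ~~ has [in [:: 7; 8; 10; 11]%N] (nreads x).
  by apply: contra x_fr; apply: sub_has; apply/allP.
have y_fr' : ~~ has [in [:: 7; 8; 10; 11]%N] (nreads y).
  by apply: contra y_fr; apply: sub_has; apply/allP.
move=> rs Qs xu yv cuv bs.
pose ix := visit_neighbors q x incr_count; pose iy := visit_neighbors q y incr_count.
pose dx := visit_neighbors q x decr_count; pose dy := visit_neighbors q y decr_count.
suff run : runs (try_candidate q x y) s (max_cost ix * (size (adj u)).+1 +
    (max_cost iy * (size (adj v)).+1 + (max_cost (record_candidate x y) +
    (max_cost dx * (size (adj u)).+1 + max_cost dy * (size (adj v)).+1))))%N
    (fun s' => consistent q (fun=> ~~ q) s' /\ best q [predU1 Some (u, v) & D] s').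
  apply: runs_weaken run _ _ => //.
  have -> : max_cost (try_candidate q x y) = (max_cost ix + (max_cost iy +
    (max_cost (record_candidate x y) + (max_cost dx + max_cost dy))))%N by [].
  move: (max_cost ix) (max_cost iy) (max_cost dx) (max_cost dy) (max_cost _).
  by move=> *; nia.
apply: runs_seq_frame (visit_neighbors_spec (g := succn)
    x_fr' rs Qs xu incr_countE) _ => s1 Q1 fr1.
have rs1 : ready s1 by apply: ready_frame fr1 _ _ rs.
have bs1 : best q D s1 by apply: best_frame fr1 _ _ _ bs.
have xu1 : neval s1 x = u.
  by rewrite (neval_frame_sub fr1 _ x_fr).
have yv1 : neval s1 y = v.
  by rewrite (neval_frame_sub fr1 _ y_fr).
apply: runs_seq_frame (visit_neighbors_spec (g := succn)
    y_fr' rs1 Q1 yv1 incr_countE) _ => s2 Q2 fr2.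
have rs2 : ready s2 by apply: ready_frame fr2 _ _ rs1.
have bs2 : best q D s2 by apply: best_frame fr2 _ _ _ bs1.
have xu2 : neval s2 x = u.
  by rewrite (neval_frame_sub fr2 _ x_fr).
have yv2 : neval s2 y = v.
  by rewrite (neval_frame_sub fr2 _ y_fr).
have tot2 : rmem s2 1 0 = weight w (survivors w dense r q (linked e q u v)).
  by case: (Q2) => _ _ ->; rewrite (consistent_linked Q2).
have y13 : 13 \notin nreads y.
  by apply: contra y_fr => y13; apply/hasP; exists 13%N.
apply: runs_seq_frame (record_candidate_spec rs2.1 xu2 yv2 y13 cuv tot2 bs2) _.
move=> s3 bs3 fr3.
have rs3 : ready s3 by apply: ready_frame fr3 _ _ rs2.
have Q3 := consistent_frame fr3 isT isT isT Q2.
have xu3 : neval s3 x = u.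
  by rewrite (neval_frame_sub fr3 _ x_fr).
have yv3 : neval s3 y = v.
  by rewrite (neval_frame_sub fr3 _ y_fr).
apply: runs_seq_frame (visit_neighbors_spec (g := predn)
    x_fr' rs3 Q3 xu3 decr_countE) _ => s4 Q4 fr4.
have rs4 : ready s4 by apply: ready_frame fr4 _ _ rs3.
have bs4 : best q [predU1 Some (u, v) & D] s4 by apply: best_frame fr4 _ _ _ bs3.
have yv4 : neval s4 y = v.
  by rewrite (neval_frame_sub fr4 _ y_fr).
apply: runs_weaken (runs_frame (visit_neighbors_spec (g := predn)
    y_fr' rs4 Q4 yv4 decr_countE)) _ _ => //.
move=> s5 [Q5 fr5]; split; last by apply: best_frame fr5 _ _ _ bs4.
(* The decrements cancel the increments, whichever of [u] and [v] the vertex is adjacent to. *)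
by apply: eq_consistent Q5 => z; case: (e v z); case: (e u z).
Qed.

Definition input_length : nat := (n + \sum_(v < n) size (adj v))%N.

Lemma leq_deg_input_length v : (size (adj v) <= input_length)%N.
Proof. by rewrite /input_length (bigD1 v) //= addnCA leq_addr. Qed.

Lemma clear_counts_spec q s : graph_input s ->
  runs clear_counts s (max_cost clear_counts * n.+1)%N (consistent q (fun=> 0%N)).
Proof.
move=> gi; pose body := Seq (SetN 7 (cell 10) (NConst 0)) (SetN 8 (cell 10) (NConst 0)).
pose I j s' := forall v : 'I_n, (v < j)%N -> nmem s' 7 v = 0%N /\ nmem s' 8 v = 0%N.
suff loop : runs (for_loop 10 (NConst 0) (cell 0) body) s
    (max_cost (for_loop 10 (NConst 0) (cell 0) body) * n.+1)%N (I n).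
  apply: runs_weaken (runs_seq_frame loop _) _ (fun s' Qs' => Qs').
    move=> s' Is' _; apply: runs_straight_line => //=.
    have out0 : output n 8 s' = set0.
      by apply/setP=> v; rewrite !inE (Is' v (ltn_ord v)).2.
    split=> [v||]; first by case: (Is' v (ltn_ord v)).
      (* A counter equal to 0 never reaches [q.+1], so there are no survivors. *)
      rewrite [LHS]out0; apply/setP=> v; rewrite !inE.
      by rewrite /counted andbF.
    by rewrite [output _ _ _]out0 /weight big_set0.
  have -> : max_cost clear_counts = (max_cost (for_loop 10 (NConst 0) (cell 0) body) +
    max_cost (SetR 1 (NConst 0) RZero))%N by [].
  by rewrite mulnDl leq_add2l leq_pmulr.
have := @runs_for_loop R 10%N (NConst 0) (cell 0) body s I (fun=> max_cost body).
rewrite [neval _ _]/= [neval _ _]/= (input_size gi) => loop.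
have cost := leq_max_cost_for_loop 10 (NConst 0) (cell 0) body 0 n; rewrite subn0 in cost.
apply: runs_weaken (loop _ _ _ _ _) cost (fun s' Qs' => Qs') => //.
move=> j s' jn s'j _ Ij.
apply: runs_straight_line => //= v; rewrite /upd /= s'j ltnS leq_eqVlt.
by rewrite /upd /=; case: eqVneq => //= _; apply: Ij.
Qed.

(** Trying [(v, v)] and [(v, r v)] costs a constant plus constant multiples of the degrees of [v]
    and [r v]. As [r] is a permutation, the degrees of the partners add up to the same total, so the
    search is linear; the 3 generously allows for reading lists twice. *)
Lemma try_all_spec q s : ready s ->
  consistent q (fun=> ~~ q) s -> best q (pred1 None) s ->
  runs (try_all q) s (3 * max_cost (try_all q) * input_length.+1)%N
    (fun s' => consistent q (fun=> ~~ q) s' /\ best q predT s').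
Proof.
move=> rs Qs bs.
pose C1 := max_cost (try_candidate q (cell 9) (cell 9)).
pose C2 := max_cost (try_candidate q (cell 9) (NGet 6 (cell 9))).
set body := If (side_test (~~ q) (cell 9))
  (Seq (try_candidate q (cell 9) (cell 9))
       (try_candidate q (cell 9) (NGet 6 (cell 9)))) Skip.
pose K := (bcost (side_test (~~ q) (cell 9))).+2%N.
pose K0 := (ncost (cell 0) + 12)%N.
pose D j := [pred b : option ('I_n * 'I_n) | if b is Some p then (p.1 < j)%N else true].
pose I j s' := consistent q (fun=> ~~ q) s' /\ best q (D j) s'.
(* [insub] turns the loop index into a vertex; the value 0 out of range is never charged. *)
pose T j := (if @insub _ _ 'I_n j is Some v
  then K + (C1 * (size (adj v) + size (adj v)).+1 +
            C2 * (size (adj v) + size (adj (r v))).+1) else 0)%N.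
have := @runs_for_loop R 9%N (NConst 0) (cell 0) body s I T.
rewrite [neval _ _]/= [neval _ _]/= (input_size rs.1) => loop.
apply: runs_weaken (loop _ _ _ _ _) _ _ => //.
- move=> j s' jn s'j fr [Qs' bs'].
  have rs' : ready s' by apply: ready_frame fr _ _ rs; case: (q).
  pose v := Ordinal jn.
  have s'v : neval s' (cell 9) = v by [].
  pose B := (C1 * (size (adj v) + size (adj v)).+1 +
             C2 * (size (adj v) + size (adj (r v))).+1)%N.
  have -> : T j = (K + B)%N by rewrite /T insubT.
  (* The only candidates new in round [j] are [(v, v)] and [(v, r v)], and only if [v] is off side
     [q]. *)
  have Dj b' : candidate dense r q b' -> D j.+1 b' ->
      dense v != q /\ [predU1 Some (v, r v) & [predU1 Some (v, v) & D j]] b' \/ D j b'.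
    case: b' => [[x y]|]; last by right.
    move=> /andP[dx xy] /=; rewrite ltnS leq_eqVlt => /orP[/eqP xj|xj]; last by right.
    left; have xv : x = v by apply: val_inj.
    rewrite xv in dx xy; split=> //; rewrite xv.
    by case/orP: xy => /eqP->; rewrite !inE eqxx ?orbT.
  set Q := fun s'' => I _ _.
  suff run : runs (if beval s' (side_test (~~ q) (cell 9))
      then Seq (try_candidate q (cell 9) (cell 9))
               (try_candidate q (cell 9) (NGet 6 (cell 9))) else Skip) s' (1 + B)%N Q.
    by apply: runs_weaken (runs_if run) _ _ => //; rewrite /K; lia.
  rewrite (beval_side_test _ rs'.1 s'v).
  have [dv|dv] := boolP (dense v == ~~ q); last first.
    apply: runs_weaken (runs_straight_line (c := Skip) (Q := eq s') isT erefl) _ _.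
      exact: (leq_addr _ 1%N).
    move=> _ <-; split; first exact: consistent_setn.
    apply: best_frame (frame_setn [::] s' 0 j.+1 (mem_head 9%N [::])) _ _ _ _ => //.
    apply: sub_best bs' => b' cb' /(Dj _ cb')[[dvq]|//].
    by move: dv dvq; case: (dense v); case: (q).
  have dvq : dense v != q by move: dv; case: (dense v); case: (q).
  have c1 : candidate dense r q (Some (v, v)) by rewrite /= dvq eqxx.
  have c2 : candidate dense r q (Some (v, r v)) by rewrite /= dvq eqxx orbT.
  suff run : runs (Seq (try_candidate q (cell 9) (cell 9))
      (try_candidate q (cell 9) (NGet 6 (cell 9)))) s' B Q.
    exact: runs_weaken run (leq_addl _ _) _.
  apply: runs_seq_frame (try_candidate_spec
    (x := cell 9) (y := cell 9) isT rs' Qs' s'v s'v c1 bs') _.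
  move=> s1 [Q1 b1] fr1; have rs1 : ready s1 by apply: ready_frame fr1 _ _ rs'.
  have s1j : nmem s1 9 0 = v by rewrite fr1.1.
  have s1r : neval s1 (NGet 6 (cell 9)) = r v by rewrite /= s1j rs1.2.
  apply: runs_weaken (try_candidate_spec
      (x := cell 9) (y := NGet 6 (cell 9)) isT rs1 Q1 s1j s1r c2 b1) _ _ => //.
  move=> s2 [Q2 b2]; split; first exact: consistent_setn.
  apply: best_frame (frame_setn [::] s2 0 j.+1 (mem_head 9%N [::])) _ _ _ _ => //.
  apply: sub_best b2 => b' cb' /(Dj _ cb')[[]//|Db'].
  by apply/orP; right; apply/orP; right.
- have -> : max_cost (try_all q) =
      (ncost (NConst 0) + K0 + ((K + (C1 + C2)) + K0))%N.
    have bodyE : max_cost body = (bcost (side_test (~~ q) (cell 9)) + (C1 + C2 + 1)).+1.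
      by [].
    by rewrite [LHS]max_cost_for_loop bodyE /K /K0; clearbody C1 C2; lia.
  rewrite big_mkord (eq_bigr (fun v : 'I_n => K + K0 + (C1 + C2) +
    (2 * C1 + C2) * size (adj v) + C2 * size (adj (r v))))%N; last first.
    by move=> v _; rewrite /T valK -/K0; nia.
  have K0E : K0 = 14%N by [].
  rewrite /=; clearbody K0 K C1 C2.
  rewrite !big_split /= !sum_nat_const card_ord -!big_distrr /=.
  have -> : (\sum_v size (adj (r v)) = \sum_v size (adj v))%N.
    by rewrite [RHS](reindex_inj (can_inj rK)).
  rewrite /input_length; move: (\sum_v _)%N => X.
  apply: (@leq_trans ((1 + K0 + K0 + K + 3 * (C1 + C2)) * (n + X).+1)%N); first by nia.
  by rewrite leq_mul2r; lia.
- by move=> s' [Q' b']; split=> //; apply: sub_best b' => -[[x y]|] /=.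
Qed.

Definition solved a q s : Prop :=
  exists b, [/\ candidate dense r q b, output n a s = solution e w dense r q b
    & forall b', candidate dense r q b' ->
        weight w (solution e w dense r q b') <= weight w (output n a s)].

(** Repeating the increments for the recorded pair reproduces the survivors linked to it, and the
    pair itself is then marked directly. The weight cell is not adjusted, since only the selection
    is copied out. *)
Lemma select_best_spec q s : ready s ->
  consistent q (fun=> ~~ q) s -> best q predT s ->
  runs (select_best q) s (max_cost (select_best q) * input_length.+1)%N (solved 8 q).
Proof.
pose C1 := max_cost (visit_neighbors q (cell 13) incr_count).
pose C2 := max_cost (visit_neighbors q (cell 14) incr_count).
pose C3 := max_cost (visit_all q q.+1).
pose K := max_cost (Seq (SetN 8 (cell 13) (NConst 1)) (SetN 8 (cell 14) (NConst 1))).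
pose K0 := bcost (BLt (cell 13) (cell 0)).
have -> : max_cost (select_best q) = (K0 + (C1 + (C2 + K) + C3)).+1 by [].
move=> rs Qs [[[x y]|] [cb eb wb mb]].
  case: eb => eb1 eb2; apply: runs_weaken (runs_if _) _ (fun s' Qs' => Qs').
    rewrite [beval _ _]/= eb1 (input_size rs.1) ltn_ord.
    apply: runs_seq_frame (visit_neighbors_spec (x := cell 13) (g := succn)
    isT rs Qs eb1 incr_countE) _.
    move=> s1 Q1 fr1; have rs1 : ready s1 by apply: ready_frame fr1 _ _ rs.
    have eb21 : nmem s1 14 0 = y by rewrite fr1.1.
    apply: runs_seq_frame (visit_neighbors_spec (x := cell 14) (g := succn)
    isT rs1 Q1 eb21 incr_countE) _.
    move=> s2 Q2 fr2.
    apply: runs_straight_line => //=.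
    have -> : nmem s2 13 0 = x by rewrite fr2.1 // fr1.1.
    rewrite /upd /=.
    have -> : nmem s2 14 0 = y by rewrite fr2.1.
    have out : output n 8 (setn (setn s2 8 x 1) 8 y 1) =
        solution e w dense r q (Some (x, y)).
      by rewrite !output_setn /= (consistent_linked Q2) setUCA.
    exists (Some (x, y)); split=> // b' cb'; rewrite [output _ _ _]out -wb.
    exact: mb.
  have := leq_deg_input_length x; have := leq_deg_input_length y; 
  by rewrite -/C1 -/C2 -/K -/K0; clearbody C1 C2 C3 K K0; nia.
apply: runs_weaken (runs_if _) _ (fun s' Qs' => Qs').
  rewrite [beval _ _]/= eb (input_size rs.1) ltnn.
  apply: runs_weaken (visit_all_spec _ rs Qs) (leqnn _) _ => s' [_ os' _].
  have out : output n 8 s' = solution e w dense r q None.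
    by rewrite os' /=; apply/setP=> v; rewrite !inE /counted eqxx.
  by exists None; split=> // b' cb'; rewrite out -wb; apply: mb.
have : (n <= input_length)%N by apply: leq_addr.
by rewrite -/C3 -/K0; clearbody C1 C2 C3 K K0; nia.
Qed.

Lemma copy_out_spec a s : a \notin [:: 0; 8; 10]%N -> graph_input s ->
  runs (copy_out a) s (max_cost (copy_out a) * n.+1)%N
    (fun s' => output n a s' = output n 8 s).
Proof.
rewrite !inE !negb_or => /and3P[a0 a8 a10] gi.
pose body := SetN a (cell 10) (NGet 8 (cell 10)).
pose I j s' := forall v : 'I_n, (v < j)%N -> nmem s' a v = nmem s 8 v.
have := @runs_for_loop R 10%N (NConst 0) (cell 0) body s I (fun=> max_cost body).
rewrite [neval _ _]/= [neval _ _]/= (input_size gi) => loop.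
have cost := leq_max_cost_for_loop 10 (NConst 0) (cell 0) body 0 n; rewrite subn0 in cost.
apply: runs_weaken (loop _ _ _ _ _) cost _ => //.
- by rewrite inE eq_sym (negPf a10).
- by rewrite /= !inE orbF [0%N == a]eq_sym (negPf a0).
- move=> j s' jn s'j fr Ij; apply: runs_straight_line => //= v.
  rewrite /setn /upd /= s'j eqxx (negPf a10) /= ltnS leq_eqVlt.
  case: eqVneq => [->|_ /=]; last exact: Ij.
  rewrite fr.1 //.
  by rewrite !inE [8%N == a]eq_sym (negPf a8).
- by move=> s' Is'; apply/setP=> v; rewrite !inE Is'.
Qed.

Lemma solve_spec q s : ready s ->
  runs (solve q) s (3 * max_cost (solve q) * input_length.+1)%N (solved (4 + q) q).
Proof.
move=> rs; have q4 : (4 + q)%N \notin [:: 0; 8; 10]%N by case: (q).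
pose init := Seq (SetR 2 (NConst 0) (rcell 1)) (SetN 13 (NConst 0) (cell 0)).
pose C1 := max_cost clear_counts; pose C2 := max_cost (visit_all q q.+1).
pose C3 := max_cost (visit_all q (~~ q)); pose C4 := max_cost (try_all q).
pose C5 := max_cost (select_best q); pose C6 := max_cost (copy_out (4 + q)).
suff run : runs (solve q) s (C1 * n.+1 + (C2 * n.+1 + (max_cost init +
    (C3 * n.+1 + (3 * C4 * input_length.+1 + (C5 * input_length.+1 + C6 * n.+1))))))%N
    (solved (4 + q) q).
  apply: runs_weaken run _ _ => //.
  have -> : max_cost (solve q) =
    (C1 + (C2 + (max_cost init + (C3 + (C4 + (C5 + C6))))))%N by [].
  have nL : (n <= input_length)%N by apply: leq_addr.
  by move: (max_cost init) => K; clearbody C1 C2 C3 C4 C5 C6; nia.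
apply: runs_seq_frame (clear_counts_spec q rs.1) _ => s1 Q1 fr1.
have rs1 : ready s1 by apply: ready_frame fr1 _ _ rs.
apply: runs_seq_frame (visit_all_spec _ rs1 Q1) _ => s2 Q2 fr2.
have rs2 : ready s2 by apply: ready_frame fr2 _ _ rs1.
apply: (runs_seq_frame (P := best q (pred1 None))).
  apply: runs_straight_line => //.
  case: (Q2) => _ os2 ws2; exists None; split=> //.
  - by rewrite /= /upd /= (input_size rs2.1).
  - rewrite /= /upd /= ws2 os2; congr (weight _ _).
    by apply/setP=> v; rewrite !inE /counted eqxx.
  - move=> b' _ /eqP->; rewrite /= /upd /= ws2 os2 le_eqVlt; apply/orP; left.
    by apply/eqP; congr (weight _ _); apply/setP=> v; rewrite !inE /counted eqxx.
move=> s3 b3 fr3; have rs3 : ready s3 by apply: ready_frame fr3 _ _ rs2.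
have Q3 := consistent_frame fr3 isT isT isT Q2.
apply: runs_seq_frame (visit_all_spec _ rs3 Q3) _ => s4 Q4 fr4.
have rs4 : ready s4 by apply: ready_frame fr4 _ _ rs3.
have b4 : best q (pred1 None) s4 by apply: best_frame fr4 _ _ _ b3.
apply: runs_seq_frame (try_all_spec rs4 Q4 b4) _ => s5 [Q5 b5] fr5.
have rs5 : ready s5 by apply: ready_frame fr5 _ _ rs4.
apply: runs_seq_frame (select_best_spec rs5 Q5 b5) _ => s6 [b [cb ob mb]] fr6.
have rs6 : ready s6 by apply: ready_frame fr6 _ _ rs5.
apply: runs_weaken (copy_out_spec q4 rs6.1) _ _ => // s7 o7.
by exists b; split=> // [|b' cb']; rewrite o7 //; apply: mb.
Qed.

(** * Computation of the partners *)

Lemma sum_vertices_spec lo hi src (b : bexp) s (l : seq 'I_n) (p : pred 'I_n) :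
  neval s hi = (neval s lo + size l)%N ->
  ~~ has [in [:: 10; 16]%N] (nreads hi) ->
  (forall s' u0 i, frame [:: 10; 16]%N [::] s s' -> (i < size l)%N ->
     nmem s' 10 0 = (neval s lo + i)%N ->
     neval s' src = nth u0 l i /\ beval s' b = p (nth u0 l i)) ->
  runs (sum_vertices lo hi src b) s
    (max_cost (sum_vertices lo hi src b) * (size l).+1)%N
    (fun s' => nmem s' 16 0 = nmem s 16 0 + \sum_(u <- l | p u) u.+1)%N.
Proof.
move=> hiE hi_fr srcE.
set body := If b (SetN 16 (NConst 0) (NAdd (cell 16) (NAdd src (NConst 1)))) Skip.
pose I j s' := (nmem s' 16 0 =
  nmem s 16 0 + \sum_(u <- take (j - neval s lo) l | p u) u.+1)%N.
apply: runs_weaken (runs_for_loop (i := 10%N) (c := body) (I := I)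
  (T := fun=> max_cost body) _ _ _ _ _) _ _ => //.
- by rewrite hiE leq_addr.
- by rewrite /I /= /upd /= subnn take0 big_nil addn0.
- move=> j s' /andP[lj jh] s'j fr Ij.
  have [i jE] : exists i, j = (neval s lo + i)%N.
    by exists (j - neval s lo)%N; rewrite subnKC.
  rewrite {}jE in lj jh s'j Ij *; rewrite hiE ltn_add2l in jh.
  have [u0 _] : exists u0 : 'I_n, u0 \in l.
    by case: (l) jh => // a *; exists a; rewrite mem_head.
  have [srcu bu] := srcE s' u0 i fr jh s'j.
  apply: runs_straight_line => //; rewrite /I -addnS addKn (take_nth u0) //.
  rewrite -cats1 big_cat big_cons big_nil /=; move: Ij; rewrite /I addKn => Ij.
  by rewrite bu; case: ifP => _; rewrite /= /upd /= Ij ?srcu; lia.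
- by apply: leq_trans (leq_max_cost_for_loop 10 _ _ _ _ _) _; rewrite hiE addKn.
- by move=> s'; rewrite /I hiE addKn take_size.
Qed.

(** A sparse vertex has no neighbor on its side except its partner; a dense one is adjacent to all
    dense vertices except itself and its partner. *)
Lemma sum_partner v : irreflexive e ->
  (\sum_(u <- adj v | dense v == dense u) u.+1 =
   let d := if r v == v then 0 else (r v).+1 in
   if dense v then \sum_(u < n | dense u) u.+1 - v.+1 - d else d)%N.
Proof.
move=> e_irr; have [uv av] := adjP v.
have -> : (\sum_(u <- adj v | dense v == dense u) u.+1 =
    \sum_(u < n | e v u && (dense v == dense u)) u.+1)%N.
  rewrite big_mkcond big_uniq //= -big_mkcondr; apply: eq_bigl => u.
  by rewrite av.
have side u : e v u && (dense v == dense u) =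
    (v != u) && (dense v == dense u) && (if dense v then u != r v else u == r v).
  have [->|vu] /= := eqVneq v u; first by rewrite e_irr.
  by have [duv|] /= := eqVneq (dense v) (dense u); rewrite ?andbF // andbT e_side.
rewrite (eq_bigl _ _ side) /=; case: ifP => dv.
  rewrite [in RHS](bigD1 v) //= addKn.
  have [rv|nrv] := eqVneq (r v) v.
    rewrite subn0; apply: eq_bigl => u.
    by rewrite rv eq_sym; case: (dense u); case: eqVneq.
  rewrite [in RHS](bigD1 (r v)) /=; last by rewrite dense_r dv.
  rewrite addKn; apply: eq_bigl => u.
  by rewrite eq_sym; case: (dense u); case: eqVneq; case: eqVneq.
have [rv|nrv] := eqVneq (r v) v.
  by rewrite big1 // => u; rewrite rv eq_sym; case: eqVneq; rewrite ?andbF.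
rewrite (big_pred1 (r v)) // => u /=.
case: (eqVneq u (r v)) => [->|]; last by rewrite andbF.
by rewrite eq_sym nrv dense_r dv.
Qed.

(** Guarantees that the truncated subtractions are exact, so that subtracting the sum over the dense
    neighbors recovers the partner. *)
Lemma dense_partner_bound v : dense v ->
  (v.+1 + (if r v == v then 0 else (r v).+1) <= \sum_(u < n | dense u) u.+1)%N.
Proof.
move=> dv; rewrite (bigD1 v) //= leq_add2l; case: ifPn => // nrv.
by rewrite (bigD1 (r v)) /= ?leq_addr // dense_r dv.
Qed.

Lemma find_partner_spec s (v : 'I_n) : irreflexive e -> graph_input s ->
  nmem s 9 0 = v -> nmem s 17 0 = (\sum_(u < n | dense u) u.+1)%N ->
  nmem s 16 0 = (\sum_(u <- adj v | dense v == dense u) u.+1)%N ->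
  runs (find_partner (cell 9)) s (max_cost (find_partner (cell 9)))
    (fun s' => nmem s' 6 v = r v /\ forall i, i != v :> nat -> nmem s' 6 i = nmem s 6 i).
Proof.
move=> e_irr gi s9 s17 s16.
(* The shift by one tells the partner 0 from the absence of a partner. *)
set d := (if r v == v then 0 else (r v).+1)%N.
apply: (runs_seq_frame (P := fun s' => nmem s' 16 0 = d)).
  apply: runs_straight_line => //=; rewrite s9 (input_dense gi).
  case: ifP => dv; rewrite /= ?s9 s16 sum_partner // dv //.
  rewrite s17 /upd /= addn1 -/d.
  have := dense_partner_bound dv; rewrite -/d.
  by move: (\sum_(u < n | _) _)%N => t; clearbody d; lia.
move=> s1 s1_16 fr; have s1_9 : nmem s1 9 0 = v by rewrite fr.1.
apply: runs_straight_line => //=; rewrite s1_16 /d.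
case: (eqVneq (r v) v) => rv; rewrite /= /upd /= ?s1_16 s1_9 eqxx /=.
  by split=> [|i /negPf->]; rewrite ?rv // fr.1.
by rewrite subn1; split=> [|i /negPf->] //; rewrite fr.1.
Qed.

(** The sum over all dense vertices is computed once in advance, so each vertex only requires a scan
    of its own list. *)
Lemma find_partners_spec s : irreflexive e -> graph_input s ->
  runs find_partners s (max_cost find_partners * input_length.+1)%N ready.
Proof.
move=> e_irr gi.
pose C1 := max_cost (sum_vertices (NConst 0) (cell 0) (cell 10) (dense_test (cell 10))).
pose C2 := max_cost (sum_vertices (NGet 1 (cell 9)) (NGet 1 (NAdd (cell 9) (NConst 1)))
  (NGet 2 (cell 10)) (same_side_test (cell 9) (NGet 2 (cell 10)))).
set body := Seq (SetN 16 (NConst 0) (NConst 0))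
  (Seq (sum_vertices (NGet 1 (cell 9)) (NGet 1 (NAdd (cell 9) (NConst 1)))
     (NGet 2 (cell 10)) (same_side_test (cell 9) (NGet 2 (cell 10))))
  (find_partner (cell 9))).
pose K := max_cost (SetN 16 (NConst 0) (NConst 0)).
pose K1 := max_cost (SetN 17 (NConst 0) (cell 16)).
pose K2 := max_cost (find_partner (cell 9)).
pose K0 := (ncost (cell 0) + 12)%N.
pose T j := (if @insub _ _ 'I_n j is Some v
  then K + (C2 * (size (adj v)).+1 + K2) else 0)%N.
suff run : runs find_partners s (K + (C1 * n.+1 + (K1 +
    (ncost (NConst 0) + ncost (cell 0) + 12 + \sum_(0 <= j < n) (T j + K0)))))%N ready.
  apply: runs_weaken run _ _ => //.
  have bodyE : max_cost body = (K + (C2 + K2))%N by [].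
  have -> : max_cost find_partners = (K + (C1 + (K1 + (ncost (NConst 0) +
      ncost (cell 0) + 12 + (K + (C2 + K2) + K0)))))%N.
    by rewrite -bodyE -(max_cost_for_loop 9).
  rewrite big_mkord (eq_bigr (fun v : 'I_n =>
    K + K2 + K0 + C2 + C2 * size (adj v)))%N; last first.
    by move=> v _; rewrite /T valK; clearbody K C1 C2 K0 K1 K2; lia.
  move: (ncost _) (ncost _); clearbody K C1 C2 K0 K1 K2 => k1 k2.
  rewrite big_split /= sum_nat_const card_ord -big_distrr /= /input_length.
  by move: (\sum_v _)%N => X; nia.
apply: runs_seq_frame; first exact: (runs_straight_line (Q := eq _)).
move=> _ <-; set s1 := denote _ s => fr1.
have gi1 : graph_input s1 by apply: graph_input_frame fr1 _ _ gi.
have := @sum_vertices_spec (NConst 0) (cell 0) (cell 10) (dense_test (cell 10))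
  s1 (enum 'I_n) dense; rewrite size_enum_ord => run1.
apply: runs_seq_frame (run1 (input_size gi1) isT _) _.
  move=> s' u0 i fr ilt s'i; have gi' : graph_input s'.
    by apply: graph_input_frame fr _ _ gi1.
  have iE : neval s' (cell 10) = nth u0 (enum 'I_n) i by rewrite nth_enum_ord.
  by split=> //; rewrite -(eqb_id (dense _)) -(beval_side_test true gi' iE).
move=> s2; rewrite /s1 /= {1}/upd /= add0n big_enum_cond /= => s2_16 fr2.
have gi2 : graph_input s2 by apply: graph_input_frame fr2 _ _ gi1.
apply: runs_seq_frame; first exact: (runs_straight_line (Q := eq _)).
move=> _ <-; set s3 := denote _ s2 => fr3.
have gi3 : graph_input s3 by apply: graph_input_frame fr3 _ _ gi2.
have s3_17 : nmem s3 17 0 = (\sum_(u < n | dense u) u.+1)%N.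
  by rewrite /= /upd /= s2_16.
clearbody s3.
pose I j s' := forall v : 'I_n, (v < j)%N -> nmem s' 6 v = r v.
have := runs_frame (@runs_for_loop R 9%N (NConst 0) (cell 0) body s3 I T _ _ _ _ _).
rewrite [neval _ _]/= [neval _ _]/= (input_size gi3) => loop.
apply: runs_weaken (loop _ _ _ _ _) _ _ => //; last first.
  move=> s' [Is' fr']; split; first by apply: graph_input_frame fr' _ _ gi3.
  by move=> v; apply: Is'.
move=> j s' jn s'9 fr Ij; pose v := Ordinal jn.
have -> : T j = (K + (C2 * (size (adj v)).+1 + K2))%N by rewrite /T insubT.
have gi' : graph_input s' by apply: graph_input_frame fr _ _ gi3.
apply: runs_seq_frame; first exact: (runs_straight_line (Q := eq _)).
move=> _ <-; set s4 := denote _ s' => fr4.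
have gi4 : graph_input s4 by apply: graph_input_frame fr4 _ _ gi'.
have s4_9 : nmem s4 9 0 = v by [].
have s4_16 : nmem s4 16 0 = 0%N by [].
have s4_17 : nmem s4 17 0 = nmem s3 17 0 by rewrite fr4.1 // fr.1.
have s4_6 i : nmem s4 6 i = nmem s' 6 i by [].
clearbody s4.
apply: runs_seq_frame (@sum_vertices_spec (NGet 1 (cell 9))
  (NGet 1 (NAdd (cell 9) (NConst 1))) _ _ s4 (adj v)
  (fun u => dense v == dense u) _ isT _) _.
- by rewrite /= s4_9 addn1 (input_offset gi4).
- move=> s5 u0 i fr5 ilt s5i.
  have gi5 : graph_input s5 by apply: graph_input_frame fr5 _ _ gi4.
  have s5_9 : nmem s5 9 0 = v by rewrite fr5.1.
  have srcE : neval s5 (NGet 2 (cell 10)) = nth u0 (adj v) i.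
    by rewrite /= s5i /= s4_9 fr5.1 // (input_neighbor gi4 u0 ilt).
  by split=> //; apply: beval_same_side_test.
move=> s5; rewrite s4_16 add0n => s5_16 fr5.
have gi5 : graph_input s5 by apply: graph_input_frame fr5 _ _ gi4.
have s5_9 : nmem s5 9 0 = v by rewrite fr5.1.
have s5_17 : nmem s5 17 0 = (\sum_(u < n | dense u) u.+1)%N.
  by rewrite fr5.1 // s4_17.
apply: runs_weaken (find_partner_spec e_irr gi5 s5_9 s5_17 s5_16) _ _ => //.
move=> s6 [s6v s6i] u; rewrite ltnS leq_eqVlt => /orP[/eqP uj|uj].
  by rewrite (_ : u = v) //; apply: val_inj.
by rewrite [LHS]s6i ?neq_ltn ?uj // fr5.1 // s4_6 Ij.
Qed.

(** * Optimality of the two results *)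

Lemma solved_optimal a q s : solved a q s ->
  homogeneous e q (output n a s) /\
  forall B, homogeneous e q B -> weight w B <= weight w (output n a s).
Proof.
case=> b [cb -> bmax]; split; first exact: solution_homogeneous.
move=> B /(solution_max w_gt0 rK dense_r e_side)[b' cb' /le_trans]; apply.
exact: bmax.
Qed.

(** The second call of [solve] writes its result to array 5, so the first result survives in array
    4. *)
Lemma solve_both_spec s : irreflexive e -> graph_input s ->
  runs mt_program s (3 * max_cost mt_program * input_length.+1)%N
    (fun s' => solved 4 false s' /\ solved 5 true s').
Proof.
move=> e_irr gi; pose C1 := max_cost find_partners.
pose C2 := max_cost (solve false); pose C3 := max_cost (solve true).
suff run : runs mt_program s (C1 * input_length.+1 + (3 * C2 * input_length.+1 +
    3 * C3 * input_length.+1))%N (fun s' => solved 4 false s' /\ solved 5 true s').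
  apply: runs_weaken run _ _ => //.
  have -> : max_cost mt_program = (C1 + (C2 + C3))%N by [].
  by clearbody C1 C2 C3; nia.
apply: runs_seq_frame (find_partners_spec e_irr gi) _ => s1 rs1 _.
apply: runs_seq_frame (solve_spec false rs1) _ => s2 [b [cb ob mb]] fr2.
have rs2 : ready s2 by apply: ready_frame fr2 _ _ rs1.
apply: runs_weaken (runs_frame (solve_spec true rs2)) _ _ => // s3 [sol3 fr3].
split=> //; exists b.
have -> : output n 4 s3 = output n 4 s2 by apply/setP=> v; rewrite !inE fr3.1.
by split.
Qed.

End Algorithm.

(** * The input encoding and the final bound *)

Lemma sum_ord_lt n (f : 'I_n -> nat) k : (k <= n)%N ->
  (\sum_(v < n | (v < k)%N) f v = \sum_(v <- take k (enum 'I_n)) f v)%N.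
Proof.
elim: k => [|k IH] kn; first by rewrite take0 big_nil big_pred0.
rewrite (take_nth (Ordinal kn)) ?size_enum_ord // -cats1 big_cat big_seq1 -IH 1?ltnW //=.
rewrite (nth_ord_enum (Ordinal kn) (Ordinal kn)) (bigD1 (Ordinal kn)) //= addnC.
congr (_ + _)%N; apply: eq_bigl => v.
by rewrite -val_eqE /= ltnS; case: ltngtP.
Qed.

Lemma graph_input_input (R : realType) n (adj : 'I_n -> seq 'I_n) (w : 'I_n -> R)
  (K Mb S : {set 'I_n}) :
  graph_input adj w (dense K Mb) (input adj w K Mb S).
Proof.
pose f k := (\sum_(v < n | (v < k)%N) size (adj v))%N.
have off k : (k <= n)%N -> nmem (input adj w K Mb S) 1 k = f k.
  by move=> kn; rewrite /= nth_mkseq.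
have fS (v : 'I_n) : f v.+1 = (f v + size (adj v))%N.
  rewrite /f (bigD1 v) //= addnC; congr (_ + _)%N; apply: eq_bigl => u.
  by rewrite -val_eqE /= ltnS; case: ltngtP.
split=> [|v|v u0 i iv|v|v].
- by [].
- by rewrite !off ?fS // ltnW.
- rewrite off 1?ltnW //= /f sum_ord_lt 1?ltnW //.
  (* The offset [f v] is the total length of the lists before [v], so position [f v + i] of the
     concatenation is position [i] in the list of [v]. *)
  rewrite -[in flatten _](cat_take_drop v (enum 'I_n)) (drop_nth v) ?size_enum_ord //.
  rewrite nth_ord_enum map_cat flatten_cat /= nth_cat.
  have -> : size (flatten [seq [seq val u | u <- adj x] | x <- take v (enum 'I_n)]) =
      (\sum_(x <- take v (enum 'I_n)) size (adj x))%N.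
    rewrite size_flatten sumnE /shape !big_map.
    by apply: eq_bigr => u _; rewrite size_map.
  by rewrite ltnNge leq_addr /= addKn nth_cat size_map iv (nth_map u0).
- rewrite /= (nth_map v) ?size_enum_ord // nth_ord_enum /block_code /dense.
  by case: (v \in K) (v \in Mb) (v \in S) => -[] [].
- by rewrite /= (nth_map v) ?size_enum_ord // nth_ord_enum.
Qed.

Lemma homogeneous_false n (e : rel 'I_n) B : irreflexive e ->
  homogeneous e false B <-> independent e B.
Proof.
move=> e_irr; split=> hB x y xB yB; last by move=> _; apply/negbTE/hB.
by have [->|nxy] := eqVneq x y; rewrite ?e_irr // hB.
Qed.

Theorem theorem6p1 (R : realType) :
  exists (P : cmd) (C : nat),
  forall (n : nat) (e : rel 'I_n) (adj : 'I_n -> seq 'I_n) (w : 'I_n -> R)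
         (K Mb S M : {set 'I_n}),
    symmetric e -> irreflexive e -> adjacency_lists e adj ->
    (forall v, 0 < w v) ->
    MT_partition e K Mb S M ->
    exists (t : nat) (s : store R),
      [/\ exec P (input adj w K Mb S) t s,
          (t <= C * (n + #|edges e|).+1)%N,
          max_weight_independent e w (output n 4 s)
        & max_weight_clique e w (output n 5 s)].
Proof.
(* The degrees add up to at most twice the number of edges, which turns the factor 3 of
   [solve_both_spec] into 6. *)
exists mt_program, (6 * max_cost mt_program)%N.
move=> n e adj w K Mb S M e_sym e_irr adjP w_gt0 mtP.
have rK := partnerK e_sym mtP; have dr := dense_partner e K Mb.
have side := edge_same_side e_sym mtP.
have := solve_both_spec adjP rK dr side e_irr (graph_input_input adj w K Mb S).
move: mt_program => P [t [s [Ps tT [sol4 sol5]]]]; exists t, s; split=> //.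
- apply: leq_trans tT _; move: (max_cost P) => C.
  by have := leq_sum_deg adjP; rewrite /input_length; nia.
- have [h4 m4] := solved_optimal e_sym w_gt0 rK dr side sol4.
  split; first exact/(homogeneous_false _ e_irr).
  by move=> B /(homogeneous_false _ e_irr); apply: m4.
- have [h5 m5] := solved_optimal e_sym w_gt0 rK dr side sol5.
  (* For [q = true], [homogeneous] unfolds to [clique]. *)
  by split=> // B cB; apply: m5.
Qed.
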